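(* Let $\Gamma=(V,E)$ be a simplicial graph of finite dimension, let $\{G_v\mid v\in V\}$ be a family of nontrivial groups, and let $G_\Gamma$ be the associated graph product, regarded as a discrete group. Let $L$ be a (Hausdorff) locally compact group and $\varphi:L\to G_\Gamma$ an abstract (not necessarily continuous) homomorphism. Then either $\varphi$ is continuous, or there exist a nonempty clique $S\subseteq V$ and $g\in G_\Gamma$ such that $\varphi(L)\subseteq g\,G_{S\cup\operatorname{lk}(S)}\,g^{-1}$. Moreover, if for every $v\in V$ the composite $r_v\circ\varphi:L\to G_v$ is continuous (with $G_v$ discrete), then $\varphi$ is continuous.
   Context: A simplicial graph $\Gamma=(V,E)$ has vertex set $V$ (possibly infinite) and edges $E$ being $2$-element subsets of $V$. A subset $S\subseteq V$ is a clique if every two distinct elements of $S$ are joined by an edge. $\Gamma$ has finite dimension if there is a uniform upper bound on the cardinalities of cliques. The graph product is $G_\Gamma=\left(\ast_{u\in V}G_u\right)/\langle\langle [G_v,G_w] \text{ for } \{v,w\}\in E\rangle\rangle$. For $S\subseteq V$, $G_S$ denotes the subgroup of $G_\Gamma$ generated by the $G_v$, $v\in S$. The link of $S\subseteq V$ is $\operatorname{lk}(S)=\{w\in V\mid \{v,w\}\in E \text{ for all } v\in S\}$. For $v\in V$, $r_v:G_\Gamma\to G_v$ is the retraction homomorphism obtained by sending $G_u$ to the identity for all $u\neq v$ and restricting to the identity on $G_v$. *)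

(* Defs.v *)
From HB Require Import structures.
From mathcomp Require Import all_boot all_order.
From mathcomp Require Import boolp classical_sets cardinality topology.
Set Implicit Arguments. Unset Strict Implicit. Unset Printing Implicit Defensive.
Local Open Scope classical_set_scope.

Definition is_group (T : Type) (mul : T -> T -> T) (one : T) (inv : T -> T) : Prop :=
  [/\ (forall x y z, mul x (mul y z) = mul (mul x y) z),
      (forall x, mul one x = x),
      (forall x, mul x one = x),
      (forall x, mul (inv x) x = one) &
      (forall x, mul x (inv x) = one)].

Record grp := Grp {
  gcar :> Type;
  gmul : gcar -> gcar -> gcar;
  gone : gcar;
  ginv : gcar -> gcar;
  gaxioms : is_group gmul gone ginv }.

Definition nontrivial_grp (G : grp) : Prop := exists a : G, a <> gone G.

Definition simplicial_graph (V : Type) (E : V -> V -> Prop) : Prop :=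
  (forall v w, E v w -> E w v) /\ (forall v, ~ E v v).

Definition clique (V : Type) (E : V -> V -> Prop) (S : set V) : Prop :=
  forall v w, S v -> S w -> v <> w -> E v w.

Definition finite_dimension (V : Type) (E : V -> V -> Prop) : Prop :=
  exists N : nat, forall S : set V, clique E S -> (S #<= `I_N)%card.

Definition link (V : Type) (E : V -> V -> Prop) (S : set V) : set V :=
  [set w | forall v, S v -> E v w].

(* Elements of the free product are represented by words of letters (v, a),
   a in G_v; G_Gamma is the quotient of words by the congruence gp_eq below
   (a monoid presentation of the graph product, which is a group). *)
Section GraphProduct.
Variables (V : Type) (E : V -> V -> Prop) (G : V -> grp).

Definition letter := {v : V & gcar (G v)}.
Definition word := seq letter.

Inductive gp_eq : word -> word -> Prop :=
  | gp_refl w : gp_eq w w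
  | gp_sym w1 w2 : gp_eq w1 w2 -> gp_eq w2 w1
  | gp_trans w1 w2 w3 : gp_eq w1 w2 -> gp_eq w2 w3 -> gp_eq w1 w3
  | gp_ctx x y u u' : gp_eq u u' -> gp_eq (x ++ u ++ y) (x ++ u' ++ y)
  | gp_one v : gp_eq [:: existT _ v (gone (G v))] [::]
  | gp_mul v (a b : G v) :
      gp_eq [:: existT _ v a; existT _ v b] [:: existT _ v (gmul a b)]
  | gp_comm v w (a : G v) (b : G w) :
      E v w -> gp_eq [:: existT _ v a; existT _ w b] [:: existT _ w b; existT _ v a].

Definition wmul (x y : word) : word := x ++ y.
Definition winv (x : word) : word :=
  rev (map (fun l : letter => existT _ (projT1 l) (ginv (projT2 l))) x).

Definition in_GS (S : set V) (x : word) : Prop :=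
  exists w : word, all (fun l : letter => `[< S (projT1 l) >]) w /\ gp_eq x w.

Definition letter_proj (v : V) (l : letter) : G v :=
  match l with
  | existT u a =>
      match pselect (u = v) with
      | left e => eq_rect u (fun u => gcar (G u)) a v e
      | right _ => gone (G v)
      end
  end.

Definition retraction (v : V) (x : word) : G v :=
  foldr (fun l acc => gmul (letter_proj v l) acc) (gone (G v)) x.

End GraphProduct.

Definition locally_compact_group (L : topologicalType)
  (mul : L -> L -> L) (one : L) (inv : L -> L) : Prop :=
  [/\ is_group mul one inv,
      continuous (fun p : L * L => mul p.1 p.2),
      continuous inv,
      hausdorff_space L &
      locally_compact [set: L]].

Definition gp_hom (L : Type) (mul : L -> L -> L) (V : Type) (E : V -> V -> Prop)
  (G : V -> grp) (phi : L -> word G) : Prop :=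
  forall x y, gp_eq E (phi (mul x y)) (wmul (phi x) (phi y)).

(* continuity into the discrete group G_Gamma: every fibre is open *)
Definition gp_continuous (L : topologicalType) (V : Type) (E : V -> V -> Prop)
  (G : V -> grp) (phi : L -> word G) : Prop :=
  forall w : word G, open [set x | gp_eq E (phi x) w].

Definition discrete_continuous (L : topologicalType) (H : Type) (f : L -> H) : Prop :=
  forall h : H, open [set x | f x = h].

(* Main.v *)
(* In a locally compact group, infinite systems u_n = w_n(u_(n+1)) of word equations are
   solvable once the coefficients of the words w_n are small enough (a variant of an idea
   of Dudley). Hence no subadditive length on the group can be expanded by such words.

   This is applied twice. Let s be a vertex, and let T_s be the Bass-Serre tree of the
   splitting of the graph product over G_lk(s). An element of a conjugate of
   G_st(s) = G_s x G_lk(s) with nontrivial G_s-component is a rotation of T_s: it fixes a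
   unique vertex q of type st(s), and its conjugate by u moves q by twice the distance from
   q to u q. So if phi(f) is a rotation, u |-> [u, f] doubles the displacement of q, and it
   follows that q is fixed by phi(U) for a neighbourhood U of 1. If no phi(f) is a rotation
   (for any s), then the syllable length of phi(f)^k is at least that of phi(f) and tends
   to infinity with k, and it follows that phi is trivial near 1.

   Choose a clique S, as large as possible, such that phi(U) lies in a conjugate of
   G_(S u lk S) for some U. By the first case the composite with the projection to G_lk(S)
   has no rotation in its image, so it is trivial near 1 and phi(U) lies in a conjugate
   g G_S g^-1 for some U. Take S minimal with this property. If S is empty, phi is
   continuous. Otherwise each s in S is the centre type of rotations in phi(U) for
   arbitrarily small U, all with the same fixed vertex; phi(L) normalises this situation,
   hence fixes these vertices, that is, phi(L) lies in g G_(S u lk S) g^-1. If moreover the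
   r_s o phi are continuous, they are trivial near 1 and S must be empty. *)
Require Import Defs.
From HB Require Import structures.
From mathcomp Require Import all_boot all_order.
From mathcomp Require Import boolp classical_sets cardinality topology.
From mathcomp Require Import zify.
Set Implicit Arguments.
Unset Strict Implicit.
Unset Printing Implicit Defensive.
Local Open Scope classical_set_scope.

(** * Elementary identities in an abstract group *)

Section GrpTheory.
Variable G : grp.
Implicit Types a b c : G.

Lemma gmulA a b c : gmul a (gmul b c) = gmul (gmul a b) c.
Proof. by case: (gaxioms G). Qed.
Lemma gmul1g a : gmul (gone G) a = a.
Proof. by case: (gaxioms G). Qed.
Lemma gmulg1 a : gmul a (gone G) = a.
Proof. by case: (gaxioms G). Qed.
Lemma gmulVg a : gmul (ginv a) a = gone G.
Proof. by case: (gaxioms G). Qed.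
Lemma gmulgV a : gmul a (ginv a) = gone G.
Proof. by case: (gaxioms G). Qed.

Lemma gmul_eq1 a b : gmul a b = gone G -> b = ginv a.
Proof. by move=> ab1; rewrite -(gmul1g b) -(gmulVg a) -gmulA ab1 gmulg1. Qed.
Lemma ginvK a : ginv (ginv a) = a.
Proof. by rewrite [RHS](@gmul_eq1 (ginv a) a) // gmulVg. Qed.
Lemma ginv1 : ginv (gone G) = gone G.
Proof. by rewrite [RHS](@gmul_eq1 (gone G) (gone G)) // gmul1g. Qed.
Lemma gmulKg a b : gmul (ginv a) (gmul a b) = b.
Proof. by rewrite gmulA gmulVg gmul1g. Qed.
Lemma gmulKVg a b : gmul a (gmul (ginv a) b) = b.
Proof. by rewrite gmulA gmulgV gmul1g. Qed.
Lemma ginvM a b : ginv (gmul a b) = gmul (ginv b) (ginv a).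
Proof. by symmetry; apply: gmul_eq1; rewrite -gmulA gmulKVg gmulgV. Qed.

End GrpTheory.

(** * Locally compact groups *)

Lemma ultra_fmap (T U : Type) (f : T -> U) (F : set_system T) :
  UltraFilter F -> UltraFilter (f @ F).
Proof.
move=> UF; split; first exact: fmap_proper_filter.
move=> H PH sFH; apply/seteqP; split=> // A HA.
case: (in_ultra_setVsetC (f @^-1` A) UF) => // FA.
have HC : H (~` A) by apply: sFH.
by case: (filter_ex (filterI HA HC)) => x [].
Qed.

Section LocallyCompactGroup.
Variables (L : topologicalType) (mul : L -> L -> L) (one : L) (inv : L -> L).
Hypothesis lcg : locally_compact_group mul one inv.

Let Lg : is_group mul one inv. Proof. by case: lcg. Qed.
Let mulA x y z : mul x (mul y z) = mul (mul x y) z. Proof. by case: Lg. Qed.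
Let mul1 x : mul one x = x. Proof. by case: Lg. Qed.
Let mulx1 x : mul x one = x. Proof. by case: Lg. Qed.
Let mulVx x : mul (inv x) x = one. Proof. by case: Lg. Qed.
Let mulxV x : mul x (inv x) = one. Proof. by case: Lg. Qed.

Lemma mul_continuous (f g : L -> L) : continuous f -> continuous g ->
  continuous (fun x => mul (f x) (g x)).
Proof.
move=> cf cg x; case: lcg => _ cm _ _ _.
apply: (@cvg_comp _ _ _ (fun x => (f x, g x)) (fun p => mul p.1 p.2) _ (nbhs (f x, g x))).
  by apply: cvg_pair; [apply: cf|apply: cg].
exact: (cm (f x, g x)).
Qed.

Lemma inv_continuous (f : L -> L) : continuous f -> continuous (fun x => inv (f x)).
Proof.
move=> cf x; case: lcg => _ _ ci _ _; apply: (@continuous_comp _ _ _ f inv x); first exact: cf.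
exact: ci.
Qed.

Lemma cst_cont (y : L) : continuous (fun _ : L => y).
Proof. by move=> x; apply: cvg_cst. Qed.

Lemma id_cont : continuous (fun x : L => x).
Proof. by move=> x. Qed.

(* If [w n] maps the identity into a prescribed small neighbourhood then the infinite
   system [u n = w n (u n.+1)] is solvable, as an ultrafilter limit of truncations. *)
Lemma expanding_words_absurd (l : L -> nat) :
  (forall U, nbhs one U -> forall D, exists (w : L -> L) C,
     [/\ continuous w, U (w one) & forall u, D <= l (w u) /\ l u <= l (w u) + C]) -> False.
Proof.
move=> H; case: lcg => _ _ _ Haus lc.
have [K nK0 [cK _]] := lc one I.
have nK : nbhs one K by move: nK0; rewrite /within /= => /filterS; apply=> x; apply.
have opK := @open_interior _ K.
(* A state holds the neighbourhood prescribed for the next word and the lower bound prescribed for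
   its length. *)
pose St := ({U : set L | open U /\ U one} * nat)%type.
have stepP (s : St) : {wC : (L -> L) * nat |
    [/\ continuous wC.1, (sval s.1) (wC.1 one) &
        forall u, s.2 <= l (wC.1 u) /\ l u <= l (wC.1 u) + wC.2]}.
  apply: cid; have [oU U1] := svalP s.1.
  have [|w [C h]] := H (sval s.1) _ s.2; first exact: open_nbhs_nbhs.
  by exists (w, C).
pose w s := (sval (stepP s)).1; pose C s := (sval (stepP s)).2.
have nextP (s : St) : open (K° `&` (w s @^-1` sval s.1)) /\ (K° `&` (w s @^-1` sval s.1)) one.
  have [cw Uw _] := svalP (stepP s); have [oU U1] := svalP s.1.
  split; last by split.
  by apply: openI => //; move/continuousP: cw; apply.
pose s0 : St := (exist _ K° (conj opK nK), 0).
(* Pulling the neighbourhood back along [w s] and cutting it with the interior of [K] keeps every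
   truncation in the compact [K]. The bound grows by [C s + 1], hence faster than the losses [C]
   accumulate. *)
pose next (s : St) : St := (exist _ _ (nextP s), (s.2 + C s).+1).
pose S n := iter n next s0.
(* The truncation [w_n (w_(n+1) (... (w_(n+j-1) 1)))]; below, [tm n m] applies the words from [n] to
   [m - 1]. *)
pose fix t (j n : nat) {struct j} : L := if j is j'.+1 then w (S n) (t j' n.+1) else one.
have tS j n : sval (S n).1 (t j n).
  elim: j n => [|j IH] n /=; first by have [] := svalP (S n).1.
  by have [_ ] := IH n.+1.
have SK n : sval (S n).1 `<=` K.
  case: n => [|n] x /=; first exact: interior_subset.
  by move=> [/interior_subset].
have [F [UF FF]] := ultraFilterLemma (eventually_filter).
pose tm n m := t (m - n) n.
have limP n : exists2 u, K u & tm n @ F --> u.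
  have UFn := ultra_fmap (tm n) UF.
  have FK : F (tm n @^-1` K).
    by apply: filterS (@filterT _ F _) => m _; exact: (SK n _ (tS (m - n) n)).
  move: cK; rewrite compact_ultra => /(_ _ UFn FK); case.
  by move=> u [Ku cu]; exists u.
have [u uP] : exists u : nat -> L, forall n, tm n @ F --> u n.
  exists (fun n => projT1 (cid2 (limP n))) => n; by case: (cid2 (limP n)).
(* Both sides are limits of the same truncations once [m > n], so they agree as [L] is Hausdorff. *)
have uE n : u n = w (S n) (u n.+1).
  have [cw _ _] := svalP (stepP (S n)).
  have UFn := ultra_fmap (tm n) UF.
  apply: (@cvg_unique _ Haus (tm n @ F)); first exact: uP.
  have : (w (S n) \o tm n.+1) @ F --> w (S n) (u n.+1).
    apply: (@cvg_comp _ _ _ (tm n.+1) (w (S n)) F (nbhs (u n.+1))); first exact: uP.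
    exact: cw.
  apply: cvg_trans; apply: near_eq_cvg.
  apply: FF; exists n.+1 => // m /= nm; rewrite /tm.
  by rewrite (_ : m - n = (m - n.+1).+1) //; move: nm; clear; lia.
have key n : l (u n) + n <= l (u 0) + (S n).2.
  elim: n => [|n IH]; first by [].
  have [_ _ /(_ (u n.+1)) [_]] := svalP (stepP (S n)).
  rewrite -[(sval _).1]/(w (S n)) -uE -[(sval _).2]/(C (S n)) => h.
  rewrite [S n.+1]/(S _) /= -/(S n); move: IH h; clear; lia.
(* At [n = l (u 0) + 1] the bound [(S n).2] exceeds [l (u n)], although it bounds
   [l (w (S n) (u n.+1)) = l (u n)] from below. *)
have := key (l (u 0)).+1.
have [_ _ /(_ (u (l (u 0)).+2)) [+ _]] := svalP (stepP (S (l (u 0)).+1)).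
rewrite -[(sval _).1]/(w (S _)) -uE; clear; lia.
Qed.

(** * Subadditive lengths that vanish near the identity *)

Section SubadditiveFunctions.
Variable l : L -> nat.
Hypotheses (lM : forall x y, l (mul x y) <= l x + l y)
  (lV : forall x, l (inv x) <= l x) (l1 : l one = 0).

Lemma no_small_zero : ~ (exists2 U, nbhs one U & forall x, U x -> l x = 0) ->
  forall U, nbhs one U -> exists2 c, U c & 0 < l c.
Proof.
move=> h U nU; apply: contrapT => nex; apply: h; exists U => // x Ux.
by apply/eqP; rewrite -leqn0 leqNgt; apply/negP => lx; apply: nex; exists x.
Qed.

(** As [l f = 0], the commutator map [e x = x f x^-1 f^-1] exactly doubles [l]. If [l] took positive
    values arbitrarily near the identity, iterates of [e] would yield expanding words. *)
Lemma conj_doubling_locally_zero f : l f = 0 ->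
  (forall x, (l x).*2 <= l (mul x (mul f (inv x)))) ->
  exists2 U, nbhs one U & forall x, U x -> l x = 0.
Proof.
move=> lf dbl; apply: contrapT => /no_small_zero small.
pose e x := mul (mul x (mul f (inv x))) (inv f).
have lfV : l (inv f) = 0 by apply/eqP; rewrite -leqn0 -lf lV.
have el x : l (e x) = (l x).*2.
  apply/eqP; rewrite eqn_leq; apply/andP; split.
    have := lM (mul x (mul f (inv x))) (inv f); have := lM x (mul f (inv x)).
    have := lM f (inv x); have := lV x; rewrite /e lfV lf; clear; lia.
  apply: leq_trans (dbl x) _; have := lM (e x) f.
  by rewrite /e -[mul (mul _ (inv f)) f]mulA mulVx mulx1 lf addn0.
have il b x : l (iter b e x) = 2 ^ b * l x.
  by elim: b => [|b IH]; rewrite ?mul1n //= el IH expnS -mul2n mulnA.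
have ce : continuous e.
  apply: mul_continuous; last exact: cst_cont.
  apply: mul_continuous; first exact: id_cont.
  by apply: mul_continuous; [exact: cst_cont|apply: inv_continuous; exact: id_cont].
have ci b (g : L -> L) : continuous g -> continuous (fun x => iter b e (g x)).
  move=> cg; elim: b => //= b IH x.
  by apply: (@continuous_comp _ _ _ (fun x => iter b e (g x)) e x); [exact: IH|exact: ce].
have inv1 : inv one = one by rewrite -[LHS]mul1 mulxV.
have i1 b : iter b e one = one.
  by elim: b => //= b ->; rewrite /e inv1 mul1 mulx1 mulxV.
apply: (@expanding_words_absurd l) => U nU D.
have [|c Uc lc] := small [set x | U (iter D e x)].
  by have := @ci D id id_cont one; apply; rewrite i1.
(* Since [2 ^ l c > l c], the inner iterate has length 0 or more than [l c]; in both cases its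
   product with [c] has positive length. The outer iterate raises this length above [D]. *)
exists (fun u => iter D e (mul (iter (l c) e u) c)), (l c); split.
- apply: (ci); apply: mul_continuous; last exact: cst_cont.
  exact: ci id_cont.
- by rewrite i1 mul1.
move=> u; rewrite il; set y := mul _ c.
have h1 : l c <= 2 ^ l c * l u + l y.
  have := lM (inv (iter (l c) e u)) y; rewrite /y mulA mulVx mul1.
  by move/leq_trans; apply; rewrite leq_add2r -il; apply: lV.
have h2 : 2 ^ l c * l u <= l y + l c.
  have := lM y (inv c); rewrite /y -mulA mulxV mulx1 il => /leq_trans; apply.
  by rewrite leq_add2l lV.
have pc : l c < 2 ^ l c by apply: ltn_expl.
have pD : D < 2 ^ D by apply: ltn_expl.
have y0 : 0 < l y.
  case: (posnP (l u)) => [u0|u0]; first by move: h1; rewrite u0 muln0; apply: leq_trans.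
  have : 2 ^ l c <= 2 ^ l c * l u by rewrite leq_pmulr.
  by move: h2 pc; clear; lia.
have hu : l u <= l y + l c by apply: leq_trans h2; rewrite leq_pmull // expn_gt0.
have hD : 2 ^ D <= 2 ^ D * l y by rewrite leq_pmulr.
have hy : l y <= 2 ^ D * l y by rewrite leq_pmull // expn_gt0.
by move: hu hD hy pD; clear; split; lia.
Qed.

Definition lpow x k := iter k (mul x) one.

Lemma power_growth_locally_zero :
  (forall x k, 0 < k -> l x <= l (lpow x k.+2) /\ (0 < l x -> k <= l (lpow x k.+2))) ->
  exists2 U, nbhs one U & forall x, U x -> l x = 0.
Proof.
move=> gr; apply: contrapT => /no_small_zero small.
have cp k (g : L -> L) : continuous g -> continuous (fun x => lpow (g x) k).
  move=> cg; elim: k => [|k IH]; first exact: cst_cont.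
  by apply: mul_continuous.
have p1 k : lpow one k = one by elim: k => //= k IH; rewrite /lpow /= mul1.
have lp x k : l x = 0 -> l (lpow x k) = 0.
  move=> lx; elim: k => // k IH; apply/eqP; rewrite -leqn0.
  by apply: leq_trans (lM _ _) _; rewrite lx -/(lpow x k) IH.
apply: (@expanding_words_absurd l) => U nU D.
have [|x Ux lx] := small [set x | U (lpow x D.+3)].
  by have := @cp D.+3 id id_cont one; apply; rewrite p1.
(* The exponent [l x + 3] is [k.+2] for [k = l x + 1], so the power of [u] is longer than [x] unless
   [l u = 0]; the product with [x] thus has positive length. The outer exponent [D + 3] then gives
   length at least [D + 1]. *)
exists (fun u => lpow (mul x (lpow u (l x).+3)) D.+3), (l x); split.
- apply: (cp); apply: mul_continuous; first exact: cst_cont.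
  exact: cp id_cont.
- by rewrite p1 mulx1.
move=> u; set v := lpow u _; set y := mul x v.
have [h1 h2] := gr u (l x).+1 isT; have [h3 h4] := gr y D.+1 isT.
rewrite -/v in h1 h2.
have a1 : l v <= l x + l y.
  have := lM (inv x) y; rewrite /y mulA mulVx mul1 => /leq_trans; apply.
  by rewrite leq_add2r lV.
have a2 : l x <= l y + l v.
  have := lM y (inv v); rewrite /y -mulA mulxV mulx1 => /leq_trans; apply.
  by rewrite leq_add2l lV.
have y0 : 0 < l y.
  case: (posnP (l u)) => [u0|/h2]; last by move: a1; clear; lia.
  by move: a2; rewrite (lp _ _ u0) addn0; apply: leq_trans.
by move: (h4 y0) h3 h1 a1; clear; split; lia.
Qed.

End SubadditiveFunctions.
End LocallyCompactGroup.

(** * Normal forms in graph products *)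

Section GraphProductWords.
Variables (V : Type) (E : V -> V -> Prop) (G : V -> grp).
Hypothesis Esym : forall v w, E v w -> E w v.
Hypothesis Eirr : forall v, ~ E v v.
Implicit Types (v s : V) (x y z : letter G) (w u p q r : word G).

Definition vt x : V := projT1 x.
Definition triv x : Prop := projT2 x = gone (G (vt x)).
Definition linv x : letter G := existT _ (projT1 x) (ginv (projT2 x)).
(** Meant for letters at the same vertex; projecting [y] makes the product total without transport
    along an equality of vertices. *)
Definition lm x y : letter G :=
  existT _ (vt x) (gmul (projT2 x) (letter_proj (vt x) y)).

Lemma letter_proj_same v (a : G v) : letter_proj v (existT _ v a) = a.
Proof. by rewrite /=; case: pselect => // e; rewrite (Prop_irrelevance e erefl). Qed.

Lemma letter_proj_diff v x : vt x <> v -> letter_proj v x = gone (G v).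
Proof. by case: x => u a /= ?; case: pselect. Qed.

Lemma lmE v (a b : G v) : lm (existT _ v a) (existT _ v b) = existT _ v (gmul a b).
Proof. by rewrite /lm /vt letter_proj_same. Qed.

Lemma lmA x y z : vt x = vt y -> vt y = vt z -> lm x (lm y z) = lm (lm x y) z.
Proof.
case: x y z => [u a] [v b] [t c]; rewrite /vt /= => uv vt0; subst.
by rewrite !lmE gmulA.
Qed.

Lemma lm_triv_l x y : vt x = vt y -> triv x -> lm x y = y.
Proof.
case: x y => [u a] [v b]; rewrite /triv /vt /= => uv ->; subst.
by rewrite lmE gmul1g.
Qed.

Lemma lm_triv_r x y : vt x = vt y -> triv y -> lm x y = x.
Proof.
case: x y => [u a] [v b]; rewrite /triv /vt /= => uv ->; subst.
by rewrite lmE gmulg1.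
Qed.

Lemma lm_triv x y : vt x = vt y -> triv (lm x y) -> y = linv x.
Proof.
case: x y => [u a] [v b]; rewrite /vt /= => uv; subst.
by rewrite lmE /triv /= => /gmul_eq1 ->.
Qed.

Lemma triv_lm_linvl x : triv (lm (linv x) x).
Proof. by case: x => u a; rewrite /linv /= lmE /triv /= gmulVg. Qed.

Lemma triv_linv x : triv (linv x) -> triv x.
Proof. by case: x => u a; rewrite /triv /= => a1; rewrite -(ginvK a) a1 ginv1. Qed.

Lemma linvK x : linv (linv x) = x.
Proof. by case: x => u a; rewrite /linv /= ginvK. Qed.

(** * Shuffles: words up to swapping neighbouring letters at adjacent vertices *)

Inductive sh : word G -> word G -> Prop :=
| sh_refl w : sh w w
| sh_swap x y w : E (vt x) (vt y) -> sh (x :: y :: w) (y :: x :: w)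
| sh_cons x w u : sh w u -> sh (x :: w) (x :: u)
| sh_trans w u r : sh w u -> sh u r -> sh w r.
Hint Resolve sh_refl sh_cons : core.

Lemma sh_sym w u : sh w u -> sh u w.
Proof.
elim=> // {w u}; first by move=> x y w /Esym/sh_swap.
- by move=> x w u _; apply: sh_cons.
- by move=> w u r _ IH1 _ IH2; apply: sh_trans IH2 IH1.
Qed.

Lemma sh_catr r w u : sh w u -> sh (w ++ r) (u ++ r).
Proof.
elim=> // {w u}; first by move=> x y w /sh_swap; apply.
- by move=> x w u _ IH; apply: sh_cons.
- by move=> w u t _ IH1 _ IH2; apply: sh_trans IH1 IH2.
Qed.

Lemma sh_catl r w u : sh w u -> sh (r ++ w) (r ++ u).
Proof. by move=> wu; elim: r => //= x r IH; apply: sh_cons. Qed.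

Lemma sh_rev w u : sh w u -> sh (rev w) (rev u).
Proof.
elim=> // {w u}.
- move=> x y w xy; rewrite !rev_cons -!cats1 -!catA; apply: sh_catl => /=.
  by apply: sh_swap; apply: Esym.
- by move=> x w u _ IH; rewrite !rev_cons -!cats1; apply: sh_catr.
- by move=> w u t _ IH1 _ IH2; apply: sh_trans IH1 IH2.
Qed.

Lemma sh_revE w u : sh (rev w) (rev u) -> sh w u.
Proof. by move/sh_rev; rewrite !revK. Qed.

Lemma sh_size w u : sh w u -> size w = size u.
Proof. by elim=> //= {w u}; [move=> x w u _ -> | move=> w u r _ -> _ ->]. Qed.

Lemma sh_count (P : pred (letter G)) w u : sh w u -> count P w = count P u.
Proof.
elim=> //= {w u}; first by move=> x y w _; rewrite addnCA.
- by move=> x w u _ ->.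
- by move=> w u r _ -> _ ->.
Qed.

Lemma sh_all (P : pred (letter G)) w u : sh w u -> all P w = all P u.
Proof. by move=> wu; rewrite !all_count (sh_count _ wu) (sh_size wu). Qed.

(* Some letter at [v] can be shuffled to the front, resp. to the end, of [w]. *)
Fixpoint first v w : Prop :=
  if w is y :: w' then vt y = v \/ (E v (vt y) /\ first v w') else False.
Definition last v w := first v (rev w).

Definition inS (S : set V) : word G -> bool := all (fun l => `[< S (vt l) >]).
Notation inlk v := (inS (E v)).

Lemma inS_sub (S T : set V) w : S `<=` T -> inS S w -> inS T w.
Proof. by move=> ST; apply: sub_all => x /asboolP/ST ?; apply/asboolP. Qed.

Lemma inS_cons (S : set V) x w : inS S (x :: w) <-> S (vt x) /\ inS S w.
Proof. by split=> [/andP[/asboolP]|[? ?]] //; apply/andP; split=> //; apply/asboolP. Qed.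

Lemma inS_cat (S : set V) w u : inS S (w ++ u) <-> inS S w /\ inS S u.
Proof. by rewrite /inS all_cat; split=> [/andP|/andP]. Qed.

Lemma inS_rev (S : set V) w : inS S (rev w) = inS S w.
Proof. exact: all_rev. Qed.

Lemma inS_sh (S : set V) w u : sh w u -> inS S w = inS S u.
Proof. exact: sh_all. Qed.

Lemma first_inS (S : set V) v w : inS S w -> first v w -> S v.
Proof.
elim: w => //= x w IH /andP[/asboolP Sx Sw] [<-//|[_]]; exact: IH.
Qed.

Lemma last_inS (S : set V) v w : inS S w -> last v w -> S v.
Proof. by rewrite -inS_rev; apply: first_inS. Qed.

Lemma first_cat v w u : first v (w ++ u) <-> first v w \/ (inlk v w /\ first v u).
Proof.
elim: w => [|x w IH] /=; first by split=> [|[//|[]]] //; right.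
rewrite IH; split.
- move=> [->|[Ev [?|[? ?]]]]; [by do 2 left|by left; right|right].
  by split=> //; apply/andP; split=> //; apply/asboolP.
- move=> [[?|[? ?]]|[/andP[/asboolP ? ?] ?]]; [by left|by right; split=> //; left|].
  by right; split=> //; right.
Qed.

Lemma last_cat v w u : last v (w ++ u) <-> last v u \/ (inlk v u /\ last v w).
Proof. by rewrite /last rev_cat first_cat inS_rev. Qed.

Lemma last_cons v x w : last v (x :: w) <-> last v w \/ (inlk v w /\ vt x = v).
Proof.
rewrite -cat1s last_cat /last /=.
by split=> [[]|[]]; [left|case=> ? [|[]//]; right|left|case=> ? ?; right; split=> //; left].
Qed.

Lemma first_clique v v' w : first v w -> first v' w -> v <> v' -> E v v'.
Proof.
elim: w => //= x w IH [<-|[Ev fv]] [<-|[Ev' fv']] // ne; last exact: IH.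
exact: Esym.
Qed.

(** Computes the decomposition promised by [first]. The extracted letter depends only on the shuffle
    class, and so does the rest up to shuffling ([pull_sh]). *)
Fixpoint pull v w : option (letter G * word G) :=
  if w is y :: w' then
    if `[< vt y = v >] then Some (y, w') else
    if `[< E v (vt y) >] then omap (fun zr => (zr.1, y :: zr.2)) (pull v w') else None
  else None.

Lemma pull_first v w : first v w -> exists z r, pull v w = Some (z, r).
Proof.
elim: w => //= y w IH h; case: asboolP => yv; first by exists y, w.
case: h => [//|[Ev /IH [z [r ->]]]]; exists z, (y :: r).
by case: asboolP.
Qed.

Lemma pull_none v w : ~ first v w -> pull v w = None.
Proof.
elim: w => //= y w IH h; case: asboolP => yv; first by case: h; left.
case: asboolP => // Ev; rewrite IH // => f; by apply: h; right.
Qed.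

Lemma pull_some v w z r : pull v w = Some (z, r) -> vt z = v /\ sh w (z :: r).
Proof.
elim: w z r => //= y w IH z r.
case: asboolP => [yv [<- <-]//|yv].
case: asboolP => // Ev; case e: (pull v w) => [[z' r']|] //= [<- <-].
have [zv sw] := IH _ _ e; split=> //; apply: sh_trans (sh_cons y sw) _.
by apply: sh_swap; rewrite zv; apply: Esym.
Qed.

Definition osh (a b : option (letter G * word G)) : Prop :=
  match a, b with
  | None, None => True
  | Some (z, r), Some (z', r') => z = z' /\ sh r r'
  | _, _ => False
  end.

Lemma pull_sh v w u : sh w u -> osh (pull v w) (pull v u).
Proof.
elim=> {w u}.
- by move=> w; case: (pull v w) => [[]|]//=.
- move=> x y w xy /=; case: (asboolP (vt x = v)) => xv; case: (asboolP (vt y = v)) => yv.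
  + by move: xy; rewrite xv yv => /Eirr.
  + by case: asboolP => //=; rewrite -xv.
  + by case: asboolP => //=; rewrite -yv => /(_ (Esym xy)).
  + case: (asboolP (E v (vt x))); case: (asboolP (E v (vt y))) => //=.
    by case: (pull v w) => [[z r]|] //=; split=> //; apply: sh_swap.
- move=> x w u wu IH /=; case: asboolP => _ //=; case: asboolP => _ //=.
  by case: (pull v w) (pull v u) IH => [[z r]|] [[z' r']|] //= [-> ?]; split=> //; apply: sh_cons.
- move=> w u r _ IH1 _ IH2.
  case: (pull v w) (pull v u) (pull v r) IH1 IH2 => [[? ?]|] [[? ?]|] [[? ?]|] //= [-> h1] [-> h2].
  by split=> //; apply: sh_trans h1 h2.
Qed.

Lemma first_sh v w u : sh w u -> first v w -> first v u.
Proof.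
move=> wu /pull_first[z [r e]]; have := pull_sh v wu; rewrite e.
case: (pselect (first v u)) => // /pull_none -> //.
Qed.

Lemma last_sh v w u : sh w u -> last v w -> last v u.
Proof. by move/sh_rev/first_sh; apply. Qed.

Lemma firstE v w : first v w -> exists z r, vt z = v /\ sh w (z :: r).
Proof. by move=> /pull_first[z [r /pull_some ?]]; exists z, r. Qed.

Lemma lastE v w : last v w -> exists z r, vt z = v /\ sh w (rcons r z).
Proof.
move=> /firstE[z [r [zv sw]]]; exists z, (rev r); split=> //.
by apply: sh_revE; rewrite rev_rcons revK.
Qed.

(** No letter is trivial and no two letters at one vertex can be shuffled next to each other. *)
Fixpoint red w : Prop :=
  if w is x :: w' then [/\ ~ triv x, ~ first (vt x) w' & red w'] else True.

Lemma red_sh w u : sh w u -> red w -> red u.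
Proof.
elim=> {w u} //.
- move=> x y w xy /= [tx fx [ty fy rw]]; split=> //.
    by case=> [e|[_ f]]; [move: xy; rewrite e => /Eirr|].
  split=> //; move=> f; apply: fx; by right.
- by move=> x w u wu IH /= [tx fx rw]; split=> //; [move/(first_sh (sh_sym wu))|exact: IH].
- by move=> w u r _ IH1 _ IH2 /IH1/IH2.
Qed.

Lemma red_cat w u : red (w ++ u) <-> [/\ red w, red u & forall v, last v w -> first v u -> False].
Proof.
elim: w => [|x w IH] /=; first by split=> [?|[]//]; split=> // v; case.
split.
- move=> [tx fx /IH[rw ru h]]; split=> //.
    by split=> // f; apply: fx; apply/first_cat; left.
  by move=> v /last_cons[/h//|[lk xv]] f; apply: fx; apply/first_cat; right; rewrite xv.
- move=> [[tx fx rw] ru h]; split=> //; last first.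
    by apply/IH; split=> // v l; apply: h; apply/last_cons; left.
  move/first_cat => [//|[lk f]]; apply: (h (vt x)) => //; apply/last_cons; by right.
Qed.

Lemma sh_gp w u : sh w u -> gp_eq E w u.
Proof.
elim=> {w u}; [exact: gp_refl| |..].
- by case=> [v a] [t b] w /(gp_comm a b); apply: (@gp_ctx _ _ _ [::] w).
- by move=> x w u _ /(@gp_ctx _ _ _ [:: x] [::]); rewrite /= !cats0.
- by move=> w u r _ h _; apply: gp_trans.
Qed.

Lemma gp_catl r w u : gp_eq E w u -> gp_eq E (r ++ w) (r ++ u).
Proof. by move=> /(gp_ctx r [::]); rewrite !cats0. Qed.

Lemma gp_catr r w u : gp_eq E w u -> gp_eq E (w ++ r) (u ++ r).
Proof. exact: (@gp_ctx _ _ _ [::] r). Qed.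

Lemma gp_cat w u w' u' : gp_eq E w u -> gp_eq E w' u' -> gp_eq E (w ++ w') (u ++ u').
Proof. by move=> /(gp_catr w') h /(gp_catl u); apply: gp_trans. Qed.

Lemma gp_triv x : triv x -> gp_eq E [:: x] [::].
Proof. by case: x => v a; rewrite /triv /= => ->; apply: gp_one. Qed.

Lemma gp_lm x y : vt x = vt y -> gp_eq E [:: x; y] [:: lm x y].
Proof.
by case: x y => [u a] [v b]; rewrite /vt /= => uv; subst; rewrite lmE; apply: gp_mul.
Qed.

(** * The action of letters on reduced words, and uniqueness of normal forms *)

Definition lmul x w :=
  if `[< triv x >] then w else
  match pull (vt x) w with
  | None => x :: w
  | Some (z, r) => if `[< triv (lm x z) >] then r else lm x z :: r
  end.

Lemma lmul_gp x w : gp_eq E (x :: w) (lmul x w).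
Proof.
rewrite /lmul; case: asboolP => [tx|_]; first exact: (gp_catr w (gp_triv tx)).
case e: (pull _ w) => [[z r]|]; last exact: gp_refl.
have [zv /sh_gp sw] := pull_some e.
have h : gp_eq E (x :: w) (lm x z :: r).
  apply: gp_trans (gp_catl [:: x] sw) _; exact: (gp_catr r (gp_lm (esym zv))).
case: asboolP => [t|//]; apply: gp_trans h _; exact: (gp_catr r (gp_triv t)).
Qed.

Lemma lmul_sh x w u : sh w u -> sh (lmul x w) (lmul x u).
Proof.
move=> wu; rewrite /lmul; case: asboolP => // _; have := pull_sh (vt x) wu.
case: (pull _ w) (pull _ u) => [[z r]|] [[z' r']|] //=; last by move=> _; apply: sh_cons.
by move=> [-> rr]; case: asboolP => // _; apply: sh_cons.
Qed.

Lemma lmul_red x w : red w -> red (lmul x w).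
Proof.
move=> rw; rewrite /lmul; case: asboolP => // tx.
case e: (pull _ w) => [[z r]|].
  have [zv /red_sh/(_ rw) /= [tz fz rr]] := pull_some e.
  by case: asboolP => // t; split=> //=; rewrite -zv.
split=> // /pull_first[z [r]]; by rewrite e.
Qed.

Lemma lmul_cons_comm y z r : E (vt y) (vt z) -> sh (lmul y (z :: r)) (z :: lmul y r).
Proof.
move=> yz; rewrite /lmul; case: asboolP => //= _.
case: asboolP => [e|_]; first by move: yz; rewrite e => /Eirr.
case: asboolP => // _; case: (pull _ r) => [[t q]|] /=; last exact: sh_swap.
by case: asboolP => // _; apply: sh_swap.
Qed.

Lemma lmul_cons_same x z r : vt z = vt x ->
  lmul x (z :: r) = if `[< triv x >] then z :: r else
                    if `[< triv (lm x z) >] then r else lm x z :: r.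
Proof. by move=> zx; rewrite /lmul /=; case: (asboolP (vt z = _)). Qed.

Lemma lmul_nfirst x w : ~ triv x -> ~ first (vt x) w -> lmul x w = x :: w.
Proof. by move=> tx fx; rewrite /lmul pull_none //; case: asboolP. Qed.

Lemma lmul_mul x y w : vt x = vt y -> red w ->
  sh (lmul x (lmul y w)) (lmul (lm x y) w).
Proof.
move=> xy rw.
case: (pselect (triv x)) => tx.
  by rewrite lm_triv_l // {1}/lmul; case: asboolP.
case: (pselect (triv y)) => ty.
  by rewrite lm_triv_r // {2}/lmul; case: asboolP.
case: (pselect (first (vt y) w)) => [/firstE[z [r [zy sw]]]|fy]; last first.
  rewrite (lmul_nfirst ty fy) lmul_cons_same ?xy //.
  case: asboolP => // _; rewrite /lmul; case: asboolP => // _.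
  by rewrite [vt (lm x y)]/vt /= -/(vt x) xy pull_none.
have [tz fz rr] := red_sh sw rw.
have fr : ~ first (vt x) r by rewrite xy -zy.
apply: sh_trans (lmul_sh _ (lmul_sh _ sw)) _.
apply: sh_trans (lmul_sh _ (sh_sym sw)).
rewrite (@lmul_cons_same y) // (@lmul_cons_same (lm x y)); last by rewrite /vt /= -/(vt x) xy.
case: asboolP => // _; rewrite -lmA //.
case: (asboolP (triv (lm y z))) => tyz.
  rewrite lmul_nfirst // (@lm_triv_r x (lm y z)) //.
  case: asboolP => txy; last by case: asboolP.
  by rewrite (lm_triv (esym zy) tyz) (lm_triv xy txy) linvK.
rewrite lmul_cons_same // (asboolF tx).
case: (asboolP (triv (lm x y))) => // txy.
have -> : lm x (lm y z) = z by rewrite lmA // lm_triv_l // /vt /= -/(vt x) xy.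
by case: asboolP.
Qed.

Lemma lmul_comm x y w : E (vt x) (vt y) -> sh (lmul x (lmul y w)) (lmul y (lmul x w)).
Proof.
move=> xy.
case: (pselect (triv x)) => tx; first by rewrite /lmul !(asboolT tx).
case: (pselect (first (vt x) w)) => [/firstE[z [r [zx sw]]]|fx].
  apply: sh_trans (lmul_sh _ (lmul_sh _ sw)) _.
  apply: sh_sym; apply: sh_trans (lmul_sh _ (lmul_sh _ sw)) _; apply: sh_sym.
  have yz : E (vt y) (vt z) by rewrite zx; apply: Esym.
  apply: sh_trans (lmul_sh _ (lmul_cons_comm _ yz)) _.
  rewrite !lmul_cons_same // (asboolF tx); case: asboolP => // _.
  by apply: sh_sym; apply: lmul_cons_comm; apply: Esym.
rewrite (lmul_nfirst tx fx).
have -> : lmul x (lmul y w) = x :: lmul y w.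
  apply: lmul_nfirst => // f; apply: fx; move: f; rewrite /lmul.
  case: asboolP => // _; case e: (pull _ w) => [[z r]|] /=; last first.
    by move=> [e'|[]//]; move: xy; rewrite e' => /Eirr.
  have [zy sw] := pull_some e.
  have fxw : first (vt x) r -> first (vt x) w.
    by move=> f; apply: (first_sh (sh_sym sw)) => /=; right; rewrite zy.
  case: asboolP => // _ /= [e'|[_]]; last exact: fxw.
  by move: xy; rewrite -e' /vt /= => /Eirr.
by apply: sh_sym; apply: lmul_cons_comm; apply: Esym.
Qed.

Definition act w u := foldr lmul u w.
Definition nf w := act w [::].

Lemma act_sh w u r : sh u r -> sh (act w u) (act w r).
Proof. by move=> ur; elim: w => //= x w; apply: lmul_sh. Qed.

Lemma act_red w u : red u -> red (act w u).
Proof. by move=> ru; elim: w => //= x w; apply: lmul_red. Qed.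

Lemma act_cat w w' u : act (w ++ w') u = act w (act w' u).
Proof. exact: foldr_cat. Qed.

(** Van der Waerden's argument: the defining relations hold for the action of letters on shuffle
    classes of reduced words. Acting on the empty word shows that a reduced word for an element is
    unique up to shuffling. *)
Lemma gp_act w w' u : gp_eq E w w' -> red u -> sh (act w u) (act w' u).
Proof.
move=> h; elim: h u => {w w'}.
- by move=> *; apply: sh_refl.
- by move=> w1 w2 _ IH u /IH/sh_sym.
- by move=> w1 w2 w3 _ IH1 _ IH2 u ru; apply: sh_trans (IH1 _ ru) (IH2 _ ru).
- move=> x y w w' _ IH u ru; rewrite !act_cat; apply: act_sh; apply: IH; exact: act_red.
- by move=> v u _ /=; rewrite /lmul; case: asboolP => // h; case: h.
- by move=> v a b u ru; rewrite /= -lmE; apply: lmul_mul.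
- by move=> v t a b vt0 u ru /=; apply: lmul_comm.
Qed.

Lemma nf_gp w : gp_eq E w (nf w).
Proof.
elim: w => [|x w IH]; first exact: gp_refl.
exact: gp_trans (gp_catl [:: x] IH) (lmul_gp _ _).
Qed.

Lemma nf_red w : red (nf w).
Proof. exact: act_red. Qed.

Lemma red_nf w : red w -> nf w = w.
Proof. by elim: w => //= x w IH [tx fx /IH rw]; rewrite /nf /= -/(nf w) rw lmul_nfirst. Qed.

Lemma nf_sh w u : gp_eq E w u -> sh (nf w) (nf u).
Proof. by move=> /gp_act; apply. Qed.

Lemma count_lmul (P : pred V) x w :
  count (P \o vt) (lmul x w) <= count (P \o vt) (x :: w).
Proof.
rewrite /lmul; case: asboolP => [_|_]; first exact: leq_addl.
case e: (pull _ w) => [[z r]|//].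
have [zx /(sh_count (P \o vt)) /= ->] := pull_some e.
case: asboolP => _ /=; first by rewrite addnA leq_addl.
by rewrite leq_add2l leq_addl.
Qed.

Lemma count_nf (P : pred V) w : count (P \o vt) (nf w) <= count (P \o vt) w.
Proof.
elim: w => //= x w IH; apply: leq_trans (count_lmul _ _ _) _ => /=.
by rewrite leq_add2l.
Qed.

Lemma size_nf w : size (nf w) <= size w.
Proof. by have := count_nf predT w; rewrite !(@eq_count _ _ predT) // !count_predT. Qed.

Lemma inS_nf (S : set V) w : inS S w -> inS S (nf w).
Proof.
have e u : inS S u = (count (predC (fun v => `[< S v >]) \o vt) u == 0).
  by rewrite -leqn0 leqNgt -has_count -all_predC; apply: eq_all => x /=; rewrite negbK.
by rewrite !e -!leqn0; apply: leq_trans; apply: count_nf.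
Qed.

(** Normalising a word never creates letters, and the result is a shuffle of [w]. *)
Lemma count_red (P : pred V) w u : red w -> gp_eq E u w ->
  count (P \o vt) w <= count (P \o vt) u.
Proof.
move=> rw /nf_sh /(sh_count (P \o vt)); rewrite (red_nf rw) => <-; exact: count_nf.
Qed.


(** * Inverse words *)

Lemma winv_cat w u : winv (w ++ u) = winv u ++ winv w.
Proof. by rewrite /winv map_cat rev_cat. Qed.

Lemma winv_cons x w : winv (x :: w) = rcons (winv w) (linv x).
Proof. by rewrite /winv /= rev_cons. Qed.

Lemma winvK w : winv (winv w) = w.
Proof.
elim: w => // x w IH.
by rewrite winv_cons -cats1 winv_cat IH winv_cons /= linvK.
Qed.

Lemma size_winv w : size (winv w) = size w.
Proof. by rewrite /winv size_rev size_map. Qed.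

Lemma inS_winv (S : set V) w : inS S (winv w) = inS S w.
Proof. by rewrite /winv inS_rev /inS all_map. Qed.

Lemma count_winv (P : pred V) w : count (P \o vt) (winv w) = count (P \o vt) w.
Proof. by rewrite /winv count_rev count_map. Qed.

Lemma first_linv v w : first v (map linv w) <-> first v w.
Proof. by elim: w => //= x w ->. Qed.

Lemma last_winv v w : last v (winv w) <-> first v w.
Proof. by rewrite /last /winv revK first_linv. Qed.

Lemma first_winv v w : first v (winv w) <-> last v w.
Proof. by rewrite -last_winv winvK. Qed.

Lemma red_winv w : red w -> red (winv w).
Proof.
elim: w => // x w IH [tx fx rw]; rewrite winv_cons -cats1; apply/red_cat; split=> //.
- exact: IH.
- by split=> // /triv_linv.
- by move=> v /last_winv f /= [vx|[]//]; apply: fx; rewrite /vt vx.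
Qed.

Lemma winv_mulV w : gp_eq E (winv w ++ w) [::].
Proof.
elim: w => [|x w IH]; first exact: gp_refl.
rewrite winv_cons cat_rcons; apply: gp_trans IH; apply: gp_catl.
apply: (@gp_catr w [:: linv x; x] [::]); apply: gp_trans (gp_lm _) (gp_triv _) => //.
exact: triv_lm_linvl.
Qed.

Lemma winv_mulKV w : gp_eq E (w ++ winv w) [::].
Proof. by have := winv_mulV (winv w); rewrite winvK. Qed.

(** * The graph product as a group *)

(** Elements are the classes themselves, as predicates on words, so that equality in the group is
    Leibniz equality. *)
Definition gpT := {c : set (word G) | exists w, c = gp_eq E w}.
Definition cls w : gpT := exist _ (gp_eq E w) (ex_intro _ w erefl).
Definition repr (c : gpT) : word G := projT1 (cid (projT2 c)).

Lemma clsP w u : cls w = cls u <-> gp_eq E w u.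
Proof.
split=> [[e]|h]; first by rewrite e; apply: gp_refl.
apply: eq_exist; apply/seteqP; split=> r wr; first exact: gp_trans (gp_sym h) wr.
exact: gp_trans h wr.
Qed.

Lemma reprK c : cls (repr c) = c.
Proof. by case: c => c cP; apply: eq_exist; rewrite /repr; case: cid => w /= ->. Qed.

Lemma cls_gp w u : gp_eq E w u -> cls w = cls u.
Proof. by move/clsP. Qed.

Lemma repr_gp w : gp_eq E (repr (cls w)) w.
Proof. by apply/clsP; rewrite reprK. Qed.

Definition gpT_mul (c d : gpT) := cls (repr c ++ repr d).
Definition gpT_inv (c : gpT) := cls (winv (repr c)).

Lemma gpT_mulE w u : gpT_mul (cls w) (cls u) = cls (w ++ u).
Proof. by apply: cls_gp; apply: gp_cat; apply: repr_gp. Qed.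

Lemma gp_winv w u : gp_eq E w u -> gp_eq E (winv w) (winv u).
Proof.
move=> wu; apply: (@gp_trans _ _ _ _ (winv w ++ (u ++ winv u))).
  by rewrite -{1}(cats0 (winv w)); apply: gp_catl; apply: gp_sym; apply: winv_mulKV.
rewrite catA; apply: (@gp_catr (winv u) _ [::]).
exact: gp_trans (gp_catl _ (gp_sym wu)) (winv_mulV _).
Qed.

Lemma gpT_axioms : is_group gpT_mul (cls [::]) gpT_inv.
Proof.
split.
- by move=> a b c; rewrite -(reprK a) -(reprK b) -(reprK c) !gpT_mulE catA.
- by move=> a; rewrite -(reprK a) gpT_mulE.
- by move=> a; rewrite -(reprK a) gpT_mulE cats0.
- by move=> a; rewrite -{2}(reprK a) gpT_mulE; apply/clsP/winv_mulV.
- by move=> a; rewrite -{1}(reprK a) gpT_mulE; apply/clsP/winv_mulKV.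
Qed.

Canonical gpG : grp := Grp gpT_axioms.

Implicit Types g h a b c f : gpG.

Lemma cls_cat w u : cls (w ++ u) = gmul (cls w : gpG) (cls u).
Proof. by rewrite -gpT_mulE. Qed.

Lemma cls_cons x w : cls (x :: w) = gmul (cls [:: x] : gpG) (cls w).
Proof. by rewrite -cls_cat. Qed.

Lemma cls_rcons x w : cls (rcons w x) = gmul (cls w : gpG) (cls [:: x]).
Proof. by rewrite -cats1 cls_cat. Qed.

Lemma cls_nil : cls [::] = gone gpG. Proof. by []. Qed.

Lemma cls_winv w : cls (winv w) = ginv (cls w : gpG).
Proof. by apply: cls_gp; apply: gp_winv; apply: gp_sym; apply: repr_gp. Qed.

Lemma cls_sh w u : sh w u -> cls w = cls u.
Proof. by move=> /sh_gp/clsP. Qed.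

Lemma cls_nf w : cls (nf w) = cls w.
Proof. by apply: cls_gp; apply: gp_sym; apply: nf_gp. Qed.

Lemma cls_triv x : triv x -> cls [:: x] = gone gpG.
Proof. by move=> /gp_triv/clsP. Qed.

Lemma cls_lm x y : vt x = vt y -> cls [:: lm x y] = gmul (cls [:: x] : gpG) (cls [:: y]).
Proof. by move=> /gp_lm/clsP <-; rewrite cls_cons. Qed.

Lemma cls_comm x w : inlk (vt x) w ->
  gmul (cls [:: x] : gpG) (cls w) = gmul (cls w : gpG) (cls [:: x]).
Proof.
elim: w => [|y w IH]; first by rewrite gmulg1 gmul1g.
move=> /inS_cons[xy /IH e]; rewrite (cls_cons y w) -gmulA -e -!cls_cat /=.
by apply: cls_sh; apply: sh_swap.
Qed.

Ltac gsimp := rewrite ?(cls_cat, cls_winv, cls_rcons, cls_nil, ginvM, ginvK, ginv1) -?gmulA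
  ?(gmulKg, gmulKVg, gmulVg, gmulgV, gmul1g, gmulg1).

(** * The subgroups [G_S] and the retractions onto vertex groups *)

Definition GS (S : set V) g := exists2 w, inS S w & g = cls w.

Lemma GS_sub (S T : set V) g : S `<=` T -> GS S g -> GS T g.
Proof. by move=> ST [w Sw ->]; exists w => //; apply: inS_sub Sw. Qed.
Lemma GS_mul (S : set V) g h : GS S g -> GS S h -> GS S (gmul g h).
Proof. by move=> [w Sw ->] [u Su ->]; exists (w ++ u); rewrite ?cls_cat //; apply/inS_cat. Qed.
Lemma GS_inv (S : set V) g : GS S g -> GS S (ginv g).
Proof. by move=> [w Sw ->]; exists (winv w); rewrite ?inS_winv ?cls_winv. Qed.
Lemma GS_one (S : set V) : GS S (gone gpG).
Proof. by exists [::]. Qed.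
Lemma GS_cls (S : set V) w : inS S w -> GS S (cls w).
Proof. by exists w. Qed.
Hint Resolve GS_one GS_cls : core.

Lemma retraction_cat v w u : retraction v (w ++ u) = gmul (retraction v w) (retraction v u).
Proof. by elim: w => [|x w IH] /=; rewrite ?gmul1g // IH gmulA. Qed.

Lemma retraction_gp v w u : gp_eq E w u -> retraction v w = retraction v u.
Proof.
elim=> {w u} //.
- by move=> w1 w2 w3 _ -> _ ->.
- by move=> x y w w' _ IH; rewrite !retraction_cat IH.
- move=> t /=; case: pselect => [e|_]; rewrite gmulg1 //.
  by subst; rewrite /=.
- by move=> t a b /=; case: pselect => [e|_]; rewrite ?gmulg1 ?gmul1g //; subst.
- move=> t t' a b tt /=; rewrite !gmulg1; case: pselect => [e|_]; case: pselect => [e'|_] //=.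
  + by subst; case: (Eirr tt).
  + by rewrite gmulg1 gmul1g.
  + by rewrite gmulg1 gmul1g.
Qed.

Definition rr v (g : gpG) : G v := retraction v (repr g).

Lemma rr_cls v w : rr v (cls w) = retraction v w.
Proof. by apply: retraction_gp; apply: repr_gp. Qed.

Lemma rr_mul v g h : rr v (gmul g h) = gmul (rr v g) (rr v h).
Proof. by rewrite -(reprK g) -(reprK h) -cls_cat !rr_cls retraction_cat. Qed.

Lemma rr_one v : rr v (gone gpG) = gone (G v).
Proof. by rewrite -cls_nil rr_cls. Qed.

Lemma rr_conj v g h : rr v (gmul g (gmul h (ginv g))) = gone _ -> rr v h = gone _.
Proof.
move=> e; have : rr v (gmul (ginv g) (gmul (gmul g (gmul h (ginv g))) g)) = rr v h by gsimp.
by move=> <-; rewrite !(rr_mul v (ginv g)) (rr_mul v _ g) e gmul1g -rr_mul gmulVg rr_one.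
Qed.

Lemma rr_nin v w : inS (fun t => t <> v) w -> rr v (cls w) = gone _.
Proof.
rewrite rr_cls; elim: w => //= x w IH /andP[/asboolP xv /IH ->].
by rewrite letter_proj_diff // gmulg1.
Qed.

Lemma rr_letter x : rr (vt x) (cls [:: x]) = projT2 x.
Proof. by rewrite rr_cls /= gmulg1; case: x => v a; apply: letter_proj_same. Qed.

(** The decomposition of [G_s x G_T]: all letters at [s] are collected in one letter [y], which may
    be trivial. *)
Lemma split_star s (T : set V) w : T `<=` E s -> inS (fun v => v = s \/ T v) w ->
  exists y l, [/\ vt y = s, inS T l & cls w = cls (y :: l)].
Proof.
move=> Ts; elim: w => [_|x w IH /inS_cons[xs /IH[y [l [ys Tl e]]]]].
  by exists (existT _ s (gone (G s))), [::]; split=> //; rewrite cls_triv.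
rewrite cls_cons e; case: xs => xs.
  by exists (lm x y), l; split=> //; rewrite (cls_cons y l) (cls_cons _ l) cls_lm ?ys // gmulA.
exists y, (x :: l); split=> //; first by apply/inS_cons.
rewrite -cls_cat; apply: cls_sh; apply: sh_swap; rewrite ys; apply: Esym; exact: Ts.
Qed.

(** * Distances in the Bass-Serre tree of a vertex *)

Lemma nat_min (P : nat -> Prop) : (exists n, P n) -> exists2 n, P n & forall m, P m -> n <= m.
Proof.
move=> [n Pn]; have ex : exists n, `[< P n >] by exists n; apply/asboolP.
by case: (ex_minnP ex) => m /asboolP Pm h; exists m => // k /asboolP/h.
Qed.

Definition st s : set V := fun v => v = s \/ E s v.
Notation star s := (GS (st s)).
Definition cnt s : word G -> nat := count ((fun v => `[< v = s >]) \o vt).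

Lemma cnt_cat s w u : cnt s (w ++ u) = cnt s w + cnt s u.
Proof. exact: count_cat. Qed.

Lemma cnt_lk s l : inlk s l -> cnt s l = 0.
Proof.
move=> h; apply/eqP; rewrite -leqn0 leqNgt -has_count -all_predC.
apply: sub_all h => x /asboolP sx /=; apply/asboolP => e; move: sx; rewrite e; exact: Eirr.
Qed.

Lemma star_split s g : star s g ->
  exists y l, [/\ vt y = s, inlk s l & g = cls (y :: l)].
Proof. by move=> [w h ->]; apply: split_star. Qed.

Lemma star_lk s l : inlk s l -> inS (st s) l.
Proof. by apply: inS_sub => v; right. Qed.

(** The distance from [q] to [g q] depends only on the double coset of [g], so words are taken from
    all of it. *)
Definition coset_cnt s g n : Prop :=
  exists w a b, [/\ star s a, star s b, cls w = gmul a (gmul g b) & cnt s w = n].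

Lemma coset_cnt_ex s g : exists n, coset_cnt s g n.
Proof.
by exists (cnt s (repr g)), (repr g), (gone gpG), (gone gpG); rewrite gmulg1 gmul1g reprK.
Qed.

Definition nuh s g : nat := projT1 (cid2 (nat_min (coset_cnt_ex s g))).

Lemma nuhP s g : coset_cnt s g (nuh s g).
Proof. by rewrite /nuh; case: cid2. Qed.

Lemma nuh_min s g n : coset_cnt s g n -> nuh s g <= n.
Proof. by rewrite /nuh; case: cid2 => /= m _; apply. Qed.

(* [nu s g] is half the distance between [g q] and [q] in the Bass-Serre tree of
   G = G_(V - s) *_(G_lk s) G_(st s), where [q] is the vertex fixed by [G_(st s)]. *)
Definition nu s g : nat := if `[< star s g >] then 0 else (nuh s g).+1.

Lemma nu_star s g : star s g -> nu s g = 0.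
Proof. by move=> h; rewrite /nu asboolT. Qed.

Lemma nu0 s g : nu s g = 0 -> star s g.
Proof. by rewrite /nu; case: asboolP. Qed.

Lemma nu_mul_starl s g h : star s g -> nu s (gmul g h) <= nu s h.
Proof.
move=> sg; rewrite /nu; case: asboolP => // ngh; case: asboolP => [sh|_].
  by case: ngh; apply: GS_mul.
rewrite ltnS; have [w [a [b [sa sb e c]]]] := nuhP s h; apply: nuh_min.
exists w, (gmul a (ginv g)), b; split=> //; first by apply: GS_mul => //; apply: GS_inv.
by rewrite e; gsimp.
Qed.

Lemma nu_inv s g : nu s (ginv g) <= nu s g.
Proof.
rewrite /nu; case: asboolP => // ng; case: asboolP => [sg|_].
  by case: ng; apply: GS_inv.
rewrite ltnS; have [w [a [b [sa sb e c]]]] := nuhP s g; apply: nuh_min.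
exists (winv w), (ginv b), (ginv a); split; try exact: GS_inv.
  by rewrite cls_winv e; gsimp.
by rewrite -c /cnt count_winv.
Qed.

Lemma nu_mul_starr s g h : star s h -> nu s (gmul g h) <= nu s g.
Proof.
move=> sh; rewrite -(ginvK (gmul g h)); apply: leq_trans (nu_inv _ _) _.
rewrite ginvM; apply: leq_trans (nu_mul_starl _ (GS_inv sh)) _; exact: nu_inv.
Qed.

(** Minimal words for the two double cosets are joined by an element of [G_st(s)], which costs at
    most one letter at [s]; the successor in [nu] pays for it. *)
Lemma nu_mul s g h : nu s (gmul g h) <= nu s g + nu s h.
Proof.
case: (pselect (star s g)) => sg; first exact: leq_trans (nu_mul_starl _ sg) (leq_addl _ _).
case: (pselect (star s h)) => sh; first exact: leq_trans (nu_mul_starr _ sh) (leq_addr _ _).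
rewrite /nu; case: asboolP => // _; do 2 (case: asboolP => // _).
have [w1 [a1 [b1 [sa1 sb1 e1 c1]]]] := nuhP s g.
have [w2 [a2 [b2 [sa2 sb2 e2 c2]]]] := nuhP s h.
have /star_split[y [l [ys lk e]]] : star s (gmul (ginv b1) (ginv a2)).
  by apply: GS_mul; apply: GS_inv.
rewrite addSn addnS ltnS -addnS.
have : coset_cnt s (gmul g h) (cnt s (w1 ++ (y :: l) ++ w2)).
  exists (w1 ++ (y :: l) ++ w2), a1, b2; split=> //.
  by rewrite cls_cat (cls_cat (y :: l)) e1 -e e2; gsimp.
move=> /nuh_min /leq_trans; apply; rewrite !cnt_cat c1 c2 leq_add2l -addn1 addnC leq_add2l.
by rewrite /cnt /= -/(cnt s l) cnt_lk // addn0 leq_b1.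
Qed.

(** [m] is a shortest word in the double coset; a first or last letter in [st s] could be absorbed
    by [a] or [b]. *)
Lemma double_coset_min s g : ~ star s g ->
  exists m, [/\ red m, (exists a b, [/\ star s a, star s b & g = gmul a (gmul (cls m) b)]),
    ~~ nilp m, (forall v, st s v -> ~ first v m) & (forall v, st s v -> ~ last v m)].
Proof.
move=> ng.
pose P n := exists m, size m = n /\
  exists a b, [/\ star s a, star s b & g = gmul a (gmul (cls m) b)].
have exP : exists n, P n.
  exists (size (repr g)), (repr g); split=> //; exists (gone gpG), (gone gpG).
  by split=> //; rewrite reprK gmulg1 gmul1g.
have [n [m0 [sm [a [b [sa sb e]]]]] nmin] := nat_min exP.
have Pm m : (exists a b, [/\ star s a, star s b & g = gmul a (gmul (cls m) b)]) -> n <= size m.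
  by move=> h; apply: nmin; exists m.
have em : g = gmul a (gmul (cls (nf m0)) b) by rewrite cls_nf.
have sz : size (nf m0) <= n by rewrite -sm; apply: size_nf.
have rm := nf_red m0.
set m := nf m0 in em sz rm *; exists m; split=> //; first by exists a, b.
- apply/negP => /nilP m0'; apply: ng; rewrite em m0' cls_nil gmul1g; exact: GS_mul.
- move=> v sv /firstE[z [r [zv shm]]].
  suff /Pm : exists a b, [/\ star s a, star s b & g = gmul a (gmul (cls r) b)].
    by rewrite leqNgt (leq_trans _ sz) // (sh_size shm).
  exists (gmul a (cls [:: z])), b; split=> //.
    by apply: GS_mul => //; apply: GS_cls; apply/inS_cons; rewrite zv.
  by rewrite em (cls_sh shm) cls_cons; gsimp.
- move=> v sv /lastE[z [r [zv shm]]].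
  suff /Pm : exists a b, [/\ star s a, star s b & g = gmul a (gmul (cls r) b)].
    by rewrite leqNgt (leq_trans _ sz) // (sh_size shm) size_rcons.
  exists a, (gmul (cls [:: z]) b); split=> //.
    by apply: GS_mul => //; apply: GS_cls; apply/inS_cons; rewrite zv.
  by rewrite em (cls_sh shm) cls_rcons; gsimp.
Qed.

Lemma cls_last v w : last v w -> exists x r, [/\ vt x = v, size w = (size r).+1,
  cls w = gmul (cls r : gpG) (cls [:: x]) & forall S, inS S w -> inS S r /\ S v].
Proof.
move=> /lastE[x [r [xv shw]]]; exists x, r; split=> //.
- by rewrite (sh_size shw) size_rcons.
- by rewrite (cls_sh shw) cls_rcons.
- by move=> S; rewrite (inS_sh _ shw) -cats1 inS_cat inS_cons xv => -[? []].
Qed.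

Lemma cls_first v w : first v w -> exists x r, [/\ vt x = v, size w = (size r).+1,
  cls w = gmul (cls [:: x] : gpG) (cls r) & forall S, inS S w -> inS S r /\ S v].
Proof.
move=> /firstE[x [r [xv shw]]]; exists x, r; split=> //.
- by rewrite (sh_size shw).
- by rewrite (cls_sh shw) cls_cons.
- by move=> S; rewrite (inS_sh _ shw) inS_cons xv => -[].
Qed.

(** Write the element as [p m (y l) m^-1 q] with [|p| + |l| + |q|] minimal. Letters of two different
    pieces among [p], [l], [q] that could meet would merge and shorten the expression, so the word
    is reduced and minimises the count at [s]. *)
Lemma cnt_conj_min s m y0 l0 a b w : red m -> ~~ nilp m ->
  (forall v, st s v -> ~ first v m) -> (forall v, st s v -> ~ last v m) ->
  vt y0 = s -> ~ triv y0 -> inlk s l0 -> star s a -> star s b ->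
  cls w = gmul a (gmul (cls (m ++ (y0 :: l0) ++ winv m)) b) ->
  (cnt s m).*2.+1 <= cnt s w.
Proof.
move=> rm m0 fm lm0 y0s ty0 lk0 [p0 sp0 ->] [q0 sq0 ->] ew.
pose P n := exists p y l q, [/\ inS (st s) p, inS (st s) q, inlk s l, vt y = s /\ ~ triv y &
  cls w = cls (p ++ m ++ (y :: l) ++ winv m ++ q) /\ size p + size l + size q = n].
have exP : exists n, P n.
  exists (size p0 + size l0 + size q0), p0, y0, l0, q0; split=> //; split=> //.
  by rewrite ew -!cls_cat -!catA.
have [n [p1 [y [l1 [q1 [sp1 sq1 lk1 [ys ty] [ew1 sz1]]]]]] nmin] := nat_min exP.
have {exP} nlt p l q : inS (st s) p -> inS (st s) q -> inlk s l ->
    cls w = cls (p ++ m ++ (y :: l) ++ winv m ++ q) -> size p + size l + size q < n -> False.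
  move=> sp sq sl e; rewrite ltnNge => /negP; apply; apply: nmin.
  by exists p, y, l, q.
set p := nf p1; set l := nf l1; set q := nf q1.
have {sp1} sp : inS (st s) p by apply: inS_nf.
have {sq1} sq : inS (st s) q by apply: inS_nf.
have {lk1} lk : inlk s l by apply: inS_nf.
have {sz1} sz : size p + size l + size q <= n.
  by rewrite -sz1 !leq_add // size_nf.
have {ew1} ew1 : cls w = cls (p ++ m ++ (y :: l) ++ winv m ++ q).
  by rewrite ew1 !cls_cat (cls_cons y l) (cls_cons y l1) /p /l /q !cls_nf.
have [rp rl rq] : [/\ red p, red l & red q] by split; apply: nf_red.
clearbody p l q.
(* Hence [y] cannot pass through [m] or its inverse to meet [p] or [q]. *)
have nlkm : ~ inlk s m.
  move=> h; case: (m) m0 h fm => // x r _ /inS_cons[sx _] /(_ (vt x)).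
  by apply; [right|left].
have stlk v : E v s -> st s v by move=> /Esym; right.
suff rw : red (p ++ m ++ (y :: l) ++ winv m ++ q).
  have := @count_red (fun v => `[< v = s >]) _ w rw ((clsP _ _).1 ew1).
  rewrite -/(cnt s w) -/(cnt s _) => /(leq_trans _); apply.
  have cy : cnt s (y :: l) = (cnt s l).+1 by rewrite /cnt /= asboolT.
  have cm : cnt s (winv m) = cnt s m by rewrite /cnt count_winv.
  by rewrite !cnt_cat cy cm; clear; lia.
apply/red_cat; split=> //; last first.
  move=> v lp; have sv := last_inS sp lp.
  move=> /first_cat[/(fm _ sv)//|[lkm [vy|[vys]]]]; first by apply: nlkm; rewrite -ys vy.
  rewrite ys in vys; move=> /first_cat[fl|[lkl /first_cat[/first_winv/(lm0 _ sv)//|[lkw fq]]]].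
  (* A letter of [l] moves left through [y] and [m] and merges into [p]. *)
  - have [x [p' [xv szp ep hp]]] := cls_last lp.
    have [z [l' [zv szl el hl]]] := cls_first fl.
    have [sp' _] := hp _ sp; have [lk' _] := hl _ lk.
    apply: (@nlt (rcons p' (lm x z)) l' q) => //.
    + by rewrite -cats1; apply/inS_cat; split=> //; apply/inS_cons; rewrite /vt /= -/(vt x) xv.
    + have cm : gmul (cls [:: z] : gpG) (cls (rcons m y)) = gmul (cls (rcons m y)) (cls [:: z]).
        by apply: cls_comm; rewrite zv -cats1; apply/inS_cat; split=> //; apply/inS_cons; rewrite ys.
      rewrite ew1 !(cls_cat, cls_rcons) ep (cls_cons y l) el (cls_cons y l') cls_lm ?xv ?zv //.
      move: cm; rewrite cls_rcons => cm.
      by rewrite -!gmulA; congr (gmul _ (gmul _ _)); rewrite !gmulA -cm !gmulA.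
    + by move: sz szp szl; rewrite size_rcons; clear; lia.
  (* A letter of [p] moves right through [m (y l) m^-1] and merges into [q]. *)
  - have [x [p' [xv szp ep hp]]] := cls_last lp.
    have [z [q' [zv szq eq hq]]] := cls_first fq.
    have [sp' _] := hp _ sp; have [sq' _] := hq _ sq.
    apply: (@nlt p' l (lm x z :: q')) => //.
    + by apply/inS_cons; rewrite /vt /= -/(vt x) xv.
    + pose M := m ++ (y :: l) ++ winv m.
      have eM t : m ++ (y :: l) ++ winv m ++ t = M ++ t by rewrite /M -!catA.
      have cm : gmul (cls [:: x]) (cls M) = gmul (cls M) (cls [:: x]).
        apply: cls_comm; rewrite xv; apply/inS_cat; split=> //; apply/inS_cat; split=> //.
        by apply/inS_cons; rewrite ys.
      rewrite ew1 !eM (cls_cat p) ep (cls_cat M) eq (cls_cat p') (cls_cat M).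
      rewrite (cls_cons (lm x z)) cls_lm ?xv ?zv // -!gmulA; congr (gmul _ _).
      by rewrite !gmulA cm.
    + by move: sz szp szq => /=; clear; lia.
apply/red_cat; split=> //; last first.
  move=> v lm1 /= [vy|[vys _]]; first by apply: (lm0 v) => //; left; rewrite -vy.
  by apply: (lm0 v) => //; apply: stlk; rewrite -ys.
split=> //.
  rewrite ys => /first_cat[/(first_inS lk)/Eirr//|[_ /first_cat[/first_winv|[lkw _]]]].
    by apply: lm0; left.
  by apply: nlkm; rewrite -(inS_winv _ m).
apply/red_cat; split=> //; last first.
  move=> v ll; have svE := last_inS lk ll.
  move=> /first_cat[/first_winv|[lkw fq]]; first by apply: lm0; right.
  (* A letter of [l] moves right through [m^-1] and merges into [q]. *)
  have [x [l' [xv szl el hl]]] := cls_last ll.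
  have [z [q' [zv szq eq hq]]] := cls_first fq.
  have [lk' _] := hl _ lk; have [sq' _] := hq _ sq.
  apply: (@nlt p l' (lm x z :: q')) => //.
  - by apply/inS_cons; rewrite /vt /= -/(vt x) xv; split=> //; right.
  - have cm : gmul (cls [:: x] : gpG) (cls (winv m)) = gmul (cls (winv m)) (cls [:: x]).
      by apply: cls_comm; rewrite xv.
    rewrite ew1 !cls_cat (cls_cons y l) el (cls_cons y l') eq (cls_cons (lm x z)).
    rewrite cls_lm ?xv ?zv // -!gmulA; congr (gmul _ (gmul _ (gmul _ (gmul _ _)))).
    by rewrite !gmulA cm.
  - by move: sz szl szq => /=; clear; lia.
apply/red_cat; split=> //; first exact: red_winv.
move=> v /last_winv f1 f2; apply: fm f1; exact: first_inS sq f2.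
Qed.

Lemma rr_lk s l : inlk s l -> rr s (cls l) = gone _.
Proof. by move=> lk; apply: rr_nin; apply: inS_sub lk => v /[swap] -> /Eirr. Qed.

Lemma rr_rot s y l : vt y = s -> inlk s l -> rr s (cls (y :: l)) = gone _ -> triv y.
Proof. by move=> <- lk; rewrite cls_cons rr_mul rr_letter rr_lk // gmulg1. Qed.

(* Conjugates of [f = y l], with [y] nontrivial in [G_s] and [l] in [G_(lk s)], rotate
   the tree about translates of [q], hence move a point twice as far as its distance
   to the centre. *)
Lemma nu_conj s g y l : vt y = s -> ~ triv y -> inlk s l ->
  (nu s g).*2 <= nu s (gmul g (gmul (cls (y :: l)) (ginv g))).
Proof.
move=> ys ty lk; set f := cls (y :: l).
case: (pselect (star s g)) => sg; first by rewrite nu_star.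
have [m [rm [a [b [sa sb eg]]] m0 fm lm0]] := double_coset_min sg.
have sf : star s f by apply: GS_cls; apply/inS_cons; split; [left|apply: star_lk].
(* With [g = a m b], the factor [b] is absorbed into the rotation; its [G_s]-component stays
   nontrivial because [r_s] is a homomorphism. *)
have /star_split[y' [l' [ys' lk' e']]] : star s (gmul b (gmul f (ginv b))).
  by apply: GS_mul => //; apply: GS_mul => //; apply: GS_inv.
have ty' : ~ triv y'.
  move=> t; apply: ty; apply: (rr_rot ys lk); apply: (@rr_conj _ b).
  by rewrite e' cls_cons cls_triv // gmul1g rr_lk.
have key w c d : star s c -> star s d ->
    cls w = gmul c (gmul (gmul g (gmul f (ginv g))) d) -> (cnt s m).*2.+1 <= cnt s w.
  move=> sc sd e; apply: (@cnt_conj_min s m y' l' (gmul c a) (gmul (ginv a) d)) => //.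
  - exact: GS_mul.
  - by apply: GS_mul => //; apply: GS_inv.
  - by rewrite e eg !cls_cat -e' cls_winv; gsimp.
have le : nuh s g <= cnt s m.
  apply: nuh_min; exists m, (ginv a), (ginv b); split; try exact: GS_inv; last by [].
  by rewrite eg; gsimp.
rewrite /nu; case: (asboolP (star s g)) => // _; case: asboolP => [h|_].
  have := key [::] (ginv (gmul g (gmul f (ginv g)))) (gone gpG) (GS_inv h) (GS_one _).
  by rewrite gmulg1 gmulVg => /(_ erefl).
have [w [c [d [sc sd e cw]]]] := nuhP s (gmul g (gmul f (ginv g))).
by move: (key _ _ _ sc sd e) le; rewrite cw; clear; lia.
Qed.

(** * Lengths of powers *)

Definition len g : nat := size (nf (repr g)).

Lemma len_cls w : len (cls w) <= size w.
Proof. by rewrite /len (sh_size (nf_sh (repr_gp w))) size_nf. Qed.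

Lemma len_red w : red w -> len (cls w) = size w.
Proof. by move=> rw; rewrite /len (sh_size (nf_sh (repr_gp w))) red_nf. Qed.

Lemma lenP g : exists2 w, g = cls w & size w = len g.
Proof. by exists (nf (repr g)) => //; rewrite cls_nf reprK. Qed.

Lemma len_mul g h : len (gmul g h) <= len g + len h.
Proof.
have [w -> <-] := lenP g; have [u -> <-] := lenP h.
by rewrite -cls_cat -size_cat len_cls.
Qed.

Lemma len_inv g : len (ginv g) <= len g.
Proof. by have [w -> <-] := lenP g; rewrite -cls_winv -size_winv len_cls. Qed.

Lemma len_eq0 g : len g = 0 -> g = gone gpG.
Proof. by have [w -> <-] := lenP g; move/size0nil => ->. Qed.

Lemma len_one : len (gone gpG) = 0.
Proof. by apply/eqP; rewrite -leqn0; apply: (len_cls [::]). Qed.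

Lemma last_rcons v w x : last v (rcons w x) <-> vt x = v \/ (E v (vt x) /\ last v w).
Proof. by rewrite /last rev_rcons. Qed.

Lemma red_rcons w x : red (rcons w x) <-> [/\ red w, ~ triv x & ~ last (vt x) w].
Proof.
rewrite -cats1; split=> [/red_cat[rw rx h]|[rw tx lx]].
  case: rx => tx _ _; split=> // l; by apply: (h (vt x)) => //; left.
by apply/red_cat; split=> //= [|v l [xv|[]//]]; [split|apply: lx; rewrite xv].
Qed.

Lemma sh_rcons_diff w u x y : sh (rcons w x) (rcons u y) -> vt x <> vt y ->
  E (vt y) (vt x) /\ exists r, sh w (rcons r y).
Proof.
move=> /sh_rev; rewrite !rev_rcons => /(pull_sh (vt y)) /=.
case: (asboolP (vt x = vt y)) => // _ + _.
rewrite (asboolT (erefl (vt y))); case: asboolP => // Exy.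
case e: (pull _ (rev w)) => [[z r]|] //= [zy _]; split=> //.
have [_ shw] := pull_some e; exists (rev r); apply: sh_revE.
by rewrite rev_rcons revK -zy.
Qed.

(** The rightmost letter at [v] is followed only by letters at neighbours of [v]. *)
Lemma last_star v w : inS (fun t => t = v \/ E v t) w -> ~ inlk v w -> last v w.
Proof.
elim: w => [_ []//|x w IH /inS_cons[xv /IH {}IH] nlk]; apply/last_cons.
case: (pselect (inlk v w)) => [lk|/IH ?]; last by left.
by right; split=> //; case: xv => // Ex; case: nlk; apply/inS_cons.
Qed.

Definition nocancel w u : Prop := forall w1 x y u1,
  sh w (rcons w1 x) -> sh u (y :: u1) -> vt x = vt y -> ~ triv (lm x y).

(** As [u] is reduced, the next pair to meet sits at a vertex other than that of [x] and [y]. It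
    commutes with these letters, so it could already meet in [w] and [u]. *)
Lemma nocancel_step w u w1 x y u1 : nocancel w u -> red u ->
  sh w (rcons w1 x) -> sh u (y :: u1) -> vt x = vt y -> nocancel (rcons w1 (lm x y)) u1.
Proof.
move=> nc ru shw shu xy w2 x' y' u2 sh1 sh2 xy'.
have [ty fy ru1] := red_sh shu ru.
have ne : vt x <> vt x'.
  move=> e; apply: fy; apply: (first_sh (sh_sym sh2)) => /=; left; by rewrite -xy' -e.
have [ex [r shr]] := sh_rcons_diff sh1 ne; rewrite [vt (lm x y)]/vt /= -/(vt x) in ex.
apply: (nc (rcons r x) x' y' (y :: u2)) => //.
  apply: sh_trans shw _; rewrite -!cats1 -catA /=.
  apply: (@sh_trans _ (r ++ [:: x'; x])).
    by have := sh_catr [:: x] shr; rewrite -cats1 -catA.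
  by apply: sh_catl; apply: sh_swap.
apply: sh_trans shu _; apply: sh_trans (sh_cons y sh2) _.
by apply: sh_swap; rewrite -xy -xy'; apply: Esym.
Qed.

(* Letters at the end of [w] may merge with letters [r] at the beginning of [u], but
   as they do not cancel, [w] keeps its length and its last vertices. *)
Lemma glue w u : red w -> red u -> nocancel w u ->
  exists w' u' r, [/\ cls (w ++ u) = cls (w' ++ u'), red (w' ++ u'), size w' = size w,
    (forall v, last v w' <-> last v w) &
    sh u (r ++ u') /\ inS (fun v => last v w) r].
Proof.
elim: {u}(size u) {-2}u (erefl (size u)) w => [|n IH] u su w rw ru nc.
  move: su => /size0nil ->; exists w, [::], [::]; split=> //.
  by rewrite cats0.
case: (pselect (exists v, last v w /\ first v u)) => [[v [lw fu]]|nex]; last first.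
  exists w, u, [::]; split=> //.
  by apply/red_cat; split=> // v lw fu; apply: nex; exists v.
have [x [w1 [xv shw]]] := lastE lw; have [y [u1 [yv shu]]] := firstE fu.
have xy : vt x = vt y by rewrite xv.
have [rw1 tx lx] := (red_rcons _ _).1 (red_sh shw rw).
have [ty fy ru1] := red_sh shu ru.
have su1 : size u1 = n by move: (sh_size shu); rewrite su /= => -[->].
have nc1 := nocancel_step nc ru shw shu xy.
have [|w' [u' [r [e rwu sw lw' [shr inr]]]]] := IH u1 su1 (rcons w1 (lm x y)) _ ru1 nc1.
  by apply/red_rcons; split=> //; apply: nc shw shu xy.
have lE t : last t (rcons w1 (lm x y)) <-> last t w.
  rewrite last_rcons [vt (lm x y)]/vt /= -/(vt x) -last_rcons.
  by split; apply: last_sh; [apply: sh_sym|]; apply: shw.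
exists w', u', (y :: r); split=> //.
- rewrite -e cls_cat (cls_sh shw) (cls_sh shu) cls_rcons (cls_cons y).
  by rewrite (cls_cat (rcons _ _)) cls_rcons cls_lm // !gmulA.
- by rewrite sw size_rcons (sh_size shw) size_rcons.
- by move=> t; rewrite lw' lE.
- split; first exact: sh_trans shu (sh_cons y shr).
  by apply/inS_cons; rewrite yv; split=> //; apply: inS_sub inr => t /lE.
Qed.

(** A last letter of [w'] at [v] that reaches [q] commutes with [u']. If it also commutes with [r],
    it commutes with all of [u], against the assumption. Otherwise [r] contains a letter at [v]; the
    other letters of [r] are at neighbours of [v], since last vertices of [w] form a clique. So [v]
    is a last vertex of [u], and [u q] is not reduced. *)
Lemma glue_app w u w' u' r q : red (w' ++ u') -> (forall v, last v w' <-> last v w) ->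
  sh u (r ++ u') -> inS (fun v => last v w) r ->
  (forall v, last v w -> inlk v u -> False) -> red (u ++ q) -> red (w' ++ u' ++ q).
Proof.
move=> rwu lw shu inr N2 /red_cat[ru rq cr]; rewrite catA; apply/red_cat; split=> //.
move=> v /last_cat[lu'|[lku' /lw lv]] fq.
  by apply: (cr v) => //; apply: (last_sh (sh_sym shu)); apply/last_cat; left.
case: (pselect (inlk v r)) => [lkr|nlk].
  by apply: (N2 v) => //; rewrite (inS_sh _ shu); apply/inS_cat.
apply: (cr v) => //; apply: (last_sh (sh_sym shu)); apply/last_cat; right; split=> //.
apply: last_star => //; apply: inS_sub inr => t lt.
case: (pselect (t = v)) => [|tv]; [by left|right].
by apply: first_clique lv lt _ => vt0; apply: tv.
Qed.

(** * Cyclically minimal conjugates and growth of powers *)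

Definition conj_rep h w u : Prop := h = gmul (cls w) (gmul (cls u) (ginv (cls w))).
Definition conj_min h w u : Prop :=
  [/\ conj_rep h w u, (forall w' u', conj_rep h w' u' -> size u <= size u') &
      (forall w' u', conj_rep h w' u' -> size u' = size u -> size w <= size w')].

Lemma conj_min_ex h : exists w u, [/\ conj_min h w u, red w & red u].
Proof.
have [|n [u1 [su1 [w1 e1]]] umin] :=
    @nat_min (fun n => exists u, size u = n /\ exists w, conj_rep h w u).
  by exists (size (repr h)), (repr h); split=> //; exists [::]; rewrite /conj_rep reprK; gsimp.
have [|k [w2 [u2 [sw2 su2 e2]]] wmin] :=
    @nat_min (fun k => exists w u, [/\ size w = k, size u = n & conj_rep h w u]).
  by exists (size w1), w1, u1.
have e : conj_rep h (nf w2) (nf u2) by rewrite /conj_rep !cls_nf.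
have su : size (nf u2) = n.
  apply/eqP; rewrite eqn_leq -{1}su2 size_nf umin //.
  by exists (nf u2); split=> //; exists (nf w2).
exists (nf w2), (nf u2); split; try exact: nf_red; split=> //.
- by move=> w' u' e'; rewrite su; apply: umin; exists u'; split=> //; exists w'.
- move=> w' u' e' su'; apply: leq_trans (size_nf _) _; rewrite sw2; apply: wmin.
  by exists w', u'; rewrite su' su.
Qed.

Lemma conj_min_inv h w u : conj_min h w u -> conj_min (ginv h) w (winv u).
Proof.
have rep w' u' : conj_rep (ginv h) w' u' -> conj_rep h w' (winv u').
  by rewrite /conj_rep cls_winv -{2}(ginvK h) => ->; gsimp.
move=> [e m1 m2]; split.
- by move: e; rewrite /conj_rep => ->; gsimp.
- by move=> w' u' /rep/m1; rewrite !size_winv.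
- by move=> w' u' /rep/m2; rewrite !size_winv; apply.
Qed.

Definition rotation s h : Prop :=
  exists a y l, [/\ vt y = s, ~ triv y, inlk s l & h = gmul a (gmul (cls (y :: l)) (ginv a))].

(** If [x] cancelled [y], the cyclic permutation [u1 y] of [u] would have the shorter conjugator
    [w1]. *)
Lemma conj_min_nocancel h w u : conj_min h w u -> nocancel w u.
Proof.
move=> [e m1 m2] w1 x y u1 shw shu xy t.
suff : size w <= size w1 by rewrite (sh_size shw) size_rcons ltnn.
apply: (m2 w1 (rcons u1 y)); last by rewrite (sh_size shu) size_rcons.
rewrite /conj_rep e (cls_sh shw) (cls_sh shu) !cls_rcons (cls_cons y).
have -> : cls [:: y] = ginv (cls [:: x]) by rewrite (lm_triv xy t) -cls_winv.
by gsimp.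
Qed.

(** A last letter of [w] that commutes with [u] cancels against its inverse. *)
Lemma conj_min_lk h w u v : conj_min h w u -> last v w -> inlk v u -> False.
Proof.
move=> [e m1 m2] /lastE[x [w1 [xv shw]]] lk.
suff : size w <= size w1 by rewrite (sh_size shw) size_rcons ltnn.
apply: (m2 w1 u) => //; rewrite /conj_rep e (cls_sh shw) !cls_rcons.
have cm := @cls_comm x u; rewrite xv in cm.
by rewrite ginvM -!gmulA (gmulA (cls [:: x])) cm // -!gmulA gmulKVg.
Qed.

(** If different letters of [u] at [v] can be moved to its two ends, conjugation merges them and
    shortens [u]. If it is one letter, it commutes with the rest of [u] and [h] is a rotation. *)
Lemma conj_min_cross h w u v : conj_min h w u -> red u -> (forall s, ~ rotation s h) ->
  last v u -> first v u -> False.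
Proof.
move=> [e m1 m2] ru nrot lv /firstE[y [u1 [yv shu]]].
have [ty fy ru1] := red_sh shu ru.
move: lv => /(last_sh shu)/last_cons[|[lk _]]; last first.
  apply: (nrot v); exists (cls w), y, u1; split=> //; by rewrite e (cls_sh shu).
move=> /lastE[x [u2 [xv shu1]]].
suff : size u <= size (lm x y :: u2).
  by rewrite (sh_size shu) /= (sh_size shu1) size_rcons ltnn.
apply: (m1 (rcons w (linv x))); rewrite /conj_rep e (cls_sh shu) (cls_cons y) (cls_sh shu1).
rewrite !cls_rcons (cls_cons (lm x y)) cls_lm ?xv ?yv //.
have -> : cls [:: linv x] = ginv (cls [:: x]) by rewrite -cls_winv.
by gsimp.
Qed.

Definition wpow u k : word G := flatten (nseq k u).

Lemma wpow_red u k : red u -> (forall v, last v u -> first v u -> False) -> red (wpow u k).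
Proof.
move=> ru cr; elim: k => // k IH; apply/red_cat; split=> // v lv fv; apply: (cr v) => //.
move: lv fv; case: k {IH} => //= k lv /first_cat[//|[lk _]].
by have := last_inS lk lv => /Eirr.
Qed.

Lemma wpowS u k : wpow u k.+1 = u ++ wpow u k. Proof. by []. Qed.

Lemma wpowSr u k : wpow u k.+1 = wpow u k ++ u.
Proof.
elim: k => [|k IH]; first by rewrite /wpow /= cats0.
by rewrite -[LHS]/(u ++ wpow u k.+1) {1}IH catA.
Qed.

Lemma size_wpow u k : size (wpow u k) = k * size u.
Proof. by elim: k => // k IH; rewrite /wpow /= size_cat IH mulSn. Qed.

Definition gpow (H : grp) (a : H) k := iter k (gmul a) (gone H).

Lemma gpow_conj h w u k : conj_rep h w u -> conj_rep (gpow h k) w (wpow u k).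
Proof.
rewrite /conj_rep => e; elim: k => [|k IH]; first by gsimp.
by rewrite /gpow iterS -/(gpow h k) IH {1}e /wpow /= -/(wpow u k) cls_cat; gsimp.
Qed.

(** In [h^(k+2) = (w u) u^k (u w^-1)] only the outer copies of [u] merge with [w] and [w^-1]. The
    reduced word obtained has length at least [2 |w| + k |u|]. *)
Lemma len_gpow h k : (forall s, ~ rotation s h) -> 0 < k ->
  len h <= len (gpow h k.+2) /\ (0 < len h -> k <= len (gpow h k.+2)).
Proof.
move=> nrot k0; have [w [u [cm rw ru]]] := conj_min_ex h.
have cr := conj_min_cross cm ru nrot.
have [e _ _] := cm.
have cm' := conj_min_inv cm.
have rpow j : red (wpow u j) by apply: wpow_red => // v; apply: cr.
(* The right end [u w^-1] is handled as the inverse of [w u^-1], which comes from the minimal form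
   of [h^-1]. *)
have [w1 [u1 [r1 [e1 red1 s1 l1 [sh1 in1]]]]] := glue rw (red_winv ru) (conj_min_nocancel cm').
have := glue_app red1 l1 sh1 in1 (fun v => conj_min_lk cm') (q := winv (wpow u k.+1)).
rewrite -winv_cat -wpowSr => /(_ (red_winv (rpow _))) /red_winv.
rewrite (winv_cat w1) (winv_cat u1) winvK wpowS -!catA => red2.
have [w2 [u2 [r2 [e2 red3 s2 l2 [sh2 in2]]]]] := glue rw ru (conj_min_nocancel cm).
have redF := glue_app red3 l2 sh2 in2 (fun v => conj_min_lk cm) red2.
have eF : gpow h k.+2 = cls (w2 ++ u2 ++ wpow u k ++ winv u1 ++ winv w1).
  rewrite catA cls_cat -e2 (cls_cat (wpow u k)) -winv_cat cls_winv -e1.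
  rewrite (gpow_conj k.+2 e) wpowSr wpowS.
  by gsimp.
rewrite eF (len_red redF) !size_cat !size_winv s1 s2 size_wpow.
have hl : len h <= size w + size u + size w.
  by rewrite e -cls_winv -!cls_cat (leq_trans (len_cls _)) // !size_cat size_winv addnA.
have u0 : 0 < len h -> 0 < size u.
  rewrite !lt0n => /eqP h0; apply/eqP => /size0nil u0; apply: h0.
  by rewrite e u0 cls_nil gmul1g gmulgV len_one.
split; first by nia.
by move=> /u0; nia.
Qed.

(** * Homomorphisms from locally compact groups *)

Definition rho (T : set V) g : gpG := cls [seq x <- (repr g) | `[< T (vt x) >]].

Lemma filter_gp (T : set V) w u : gp_eq E w u ->
  gp_eq E [seq x <- w | `[< T (vt x) >]] [seq x <- u | `[< T (vt x) >]].
Proof.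
elim=> {w u}.
- by move=> w; apply: gp_refl.
- by move=> w u _; apply: gp_sym.
- by move=> w u r _ IH1 _; apply: gp_trans.
- by move=> x y w u _ IH; rewrite !filter_cat; apply: gp_ctx.
- by move=> v /=; case: asboolP => _; [apply: gp_one|apply: gp_refl].
- by move=> v a b /=; case: asboolP => _; [apply: gp_mul|apply: gp_refl].
- move=> v t a b vt0 /=; case: asboolP => _; case: asboolP => _; try exact: gp_refl.
  exact: gp_comm.
Qed.

Lemma rho_cls (T : set V) w : rho T (cls w) = cls [seq x <- w | `[< T (vt x) >]].
Proof. by apply: cls_gp; apply: filter_gp; apply: repr_gp. Qed.

Lemma rho_mul (T : set V) g h : rho T (gmul g h) = gmul (rho T g) (rho T h).
Proof. by rewrite -(reprK g) -(reprK h) -cls_cat !rho_cls filter_cat cls_cat. Qed.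

Lemma rho_inv (T : set V) g : rho T (ginv g) = ginv (rho T g).
Proof. by apply: gmul_eq1; rewrite -rho_mul gmulgV -cls_nil rho_cls. Qed.

Lemma rho_id (T : set V) g : GS T g -> rho T g = g.
Proof. by move=> [w Tw ->]; rewrite rho_cls; congr cls; apply/all_filterP. Qed.

Lemma GS_rho (S T : set V) g : GS S g -> GS (S `&` T) (rho T g).
Proof.
move=> [w Sw ->]; rewrite rho_cls; apply: GS_cls.
elim: w Sw => //= x w IH /andP[/asboolP Sx /IH Tw]; case: asboolP => // Tx.
by apply/inS_cons.
Qed.

Lemma GS_rhoT (T : set V) g : GS T (rho T g).
Proof.
have h : GS [set: V] g.
  by exists (repr g); rewrite ?reprK //; apply/allT => x; apply/asboolP.
by apply: GS_sub (GS_rho T h) => v [].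
Qed.

Lemma GS_comm (S T : set V) g h : (forall t v, S t -> T v -> E t v) ->
  GS S g -> GS T h -> gmul g h = gmul h g.
Proof.
move=> ST [w Sw ->] [u Tu ->]; elim: w Sw => [|x w IH /inS_cons[Sx /IH e]].
  by rewrite cls_nil gmul1g gmulg1.
rewrite (cls_cons x w) -gmulA e !gmulA; congr (gmul _ _); apply: cls_comm.
by apply: inS_sub Tu => v; apply: ST.
Qed.

(** [G_S] and [G_T] commute, so a new letter of [T] in front is moved past the [G_S]-factor
    collected so far. *)
Lemma GS_prod (S T : set V) g : (forall t v, S t -> T v -> E t v) ->
  GS (S `|` T) g -> exists2 h, GS S h & g = gmul h (rho T g).
Proof.
move=> ST [w STw ->]; rewrite rho_cls.
elim: w STw => [_|x w IH /inS_cons[STx /IH[h Sh e]]]; first by exists (gone gpG) => //; rewrite gmul1g.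
have [k Tk ek] : exists2 k, GS T k & k = cls [seq x <- w | `[< T (vt x) >]].
  by exists (rho T (cls w)); [exact: GS_rhoT|rewrite rho_cls].
rewrite -ek in e; rewrite cls_cons e /=; case: STx => STx; case: asboolP => Tx.
- by case: (Eirr (ST _ _ STx Tx)).
- rewrite -ek; exists (gmul (cls [:: x]) h); last by rewrite gmulA.
  by apply: GS_mul => //; apply: GS_cls; apply/inS_cons.
- exists h => //; rewrite [X in _ = gmul h X](_ : _ = gmul (cls [:: x]) k); last first.
    by rewrite ek -cls_cons.
  rewrite !gmulA; congr (gmul _ _).
  by symmetry; apply: (GS_comm ST Sh); apply: GS_cls; apply/inS_cons.
- by [].
Qed.

(** One normal form serves all [i]: by uniqueness up to shuffling it uses only vertices of each
    [S i]. *)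
Lemma GS_inter (I : Type) (P : I -> Prop) (S : I -> set V) g :
  (forall i, P i -> GS (S i) g) -> GS [set v | forall i, P i -> S i v] g.
Proof.
move=> h; exists (nf (repr g)); last by rewrite cls_nf reprK.
have : forall i, P i -> inS (S i) (nf (repr g)).
  move=> i /h[w Sw e]; rewrite (inS_sh _ (@nf_sh _ w _)); first exact: inS_nf.
  by apply/clsP; rewrite reprK.
elim: (nf _) => //= x w IH Sx; apply/andP; split.
  by apply/asboolP => i /Sx/andP[/asboolP].
by apply: IH => i /Sx/andP[].
Qed.

Lemma GS_set0 g : GS set0 g -> g = gone gpG.
Proof. by move=> [[|x w]] // /inS_cons[]. Qed.

(** Finite cliques as lists; irreflexivity of [E] excludes repetitions, so [size] is the
    cardinality. *)
Fixpoint clq (S : seq V) : Prop :=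
  if S is v :: S' then (forall t, List.In t S' -> E v t) /\ clq S' else True.
Definition mem_list (S : seq V) : set V := fun v => List.In v S.

Lemma clq_clique S : clq S -> clique E (mem_list S).
Proof.
elim: S => [_ v w []|u S IH [uS /IH cS]] v w /= [<-|vS] [<-|wS] vw //.
- exact: uS.
- by apply: Esym; apply: uS.
- exact: cS.
Qed.

Lemma clq_nth S v0 i j : clq S -> i < j -> j < size S -> E (nth v0 S i) (nth v0 S j).
Proof.
elim: S i j => //= v S IH [|i] [|j] // [vS cS] ij jS; last exact: IH.
apply: vS; elim: S j jS {IH cS ij} => //= u S IH [|j] jS; [by left|right; exact: IH].
Qed.

Lemma mem_list_nth S v0 i : i < size S -> mem_list S (nth v0 S i).
Proof. by elim: S i => //= v S IH [|i] iS; [left|right; apply: IH]. Qed.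

Lemma clq_size N S : (forall A : set V, clique E A -> (A #<= `I_N)%card) -> clq S -> size S <= N.
Proof.
move=> fd cS; case: S cS => // v S; set S' := v :: S => cS.
rewrite -card_le_II; apply: card_le_trans (fd _ (clq_clique cS)).
have inj : {in `I_(size S') &, injective (nth v S')}.
  move=> i j; rewrite !inE /= => iS jS e; case: (ltngtP i j) => // ij.
  - by have := clq_nth v cS ij jS; rewrite e => /Eirr.
  - by have := clq_nth v cS ij iS; rewrite e => /Eirr.
have := inj_card_eq inj; rewrite card_eq_le => /andP[_ /card_le_trans]; apply.
by apply: subset_card_le => _ [i iS <-]; exact: (@mem_list_nth S' v i iS).
Qed.

Lemma clq_rem S s : clq S -> List.In s S -> exists S', [/\ clq S', size S' < size S,
  mem_list S' `<=` E s, mem_list S' `<=` mem_list S &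
  mem_list S `<=` [set v | v = s \/ mem_list S' v]].
Proof.
elim: S => //= v S IH [vS cS] [<-|sS].
  exists S; split=> // u /=; [by right|by case=> [->|]; [left|right]].
have [S' [cS' sz lk sub' sub]] := IH cS sS; exists (v :: S'); split=> //=.
- by split=> // u /sub'; apply: vS.
- by move=> u [<-|/lk//]; apply: Esym; apply: vS.
- by move=> u [<-|/sub']; [left|right].
- by move=> u [<-|/sub[->|]]; [right; left|left|right; right].
Qed.

(** * Local images of homomorphisms and their rotations *)

Section Homomorphism.
Variables (L : topologicalType) (mul : L -> L -> L) (one : L) (inv : L -> L).
Hypothesis lcg : locally_compact_group mul one inv.

Implicit Types (psi phi : L -> gpG).

Definition hom psi : Prop := forall x z : L, psi (mul x z) = gmul (psi x) (psi z).

Lemma hom_one psi : hom psi -> psi one = gone gpG.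
Proof.
move=> hp; case: lcg => -[_ m1 _ _ _] _ _ _ _.
by have := hp one one; rewrite m1 => e; rewrite -(gmulKg (psi one) (psi one)) -e gmulVg.
Qed.

Lemma hom_inv psi (x : L) : hom psi -> psi (inv x) = ginv (psi x).
Proof.
move=> hp; case: lcg => -[_ _ _ _ mV] _ _ _ _.
by apply: gmul_eq1; rewrite -hp mV hom_one.
Qed.

Lemma hom_conj psi a : hom psi -> hom (fun x : L => gmul (ginv a) (gmul (psi x) a)).
Proof. by move=> hp x y; rewrite hp; gsimp. Qed.

(** The length [z |-> nu s (a^-1 psi(z) a)] vanishes at [x0], and [nu_conj] gives the doubling under
    conjugation of [x0]. *)
Lemma rotation_star psi (x0 : L) s a y l : hom psi -> vt y = s -> ~ triv y -> inlk s l ->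
  psi x0 = gmul a (gmul (cls (y :: l)) (ginv a)) ->
  exists2 U, nbhs one U & forall x : L, U x -> star s (gmul (ginv a) (gmul (psi x) a)).
Proof.
move=> hp ys ty lk e; pose psi' (x : L) := gmul (ginv a) (gmul (psi x) a).
have hc : hom psi' by apply: hom_conj.
have e' : psi' x0 = cls (y :: l) by rewrite /psi' e; gsimp.
have sf : star s (psi' x0).
  by rewrite e'; apply: GS_cls; apply/inS_cons; split; [left|apply: star_lk].
have [|||z|U nU h] := @conj_doubling_locally_zero L mul one inv lcg
    (fun x : L => nu s (psi' x)) _ _ x0.
- by move=> z z'; rewrite hc nu_mul.
- by move=> z; rewrite hom_inv // nu_inv.
- exact: nu_star.
- by rewrite !hc hom_inv // e' nu_conj.
- by exists U => // z /h/nu0.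
Qed.

Lemma no_rotation_trivial psi : hom psi -> (forall s (x : L), ~ rotation s (psi x)) ->
  exists2 U, nbhs one U & forall x : L, U x -> psi x = gone gpG.
Proof.
move=> hp nrot.
have hpow (x : L) k : psi (lpow mul one x k) = gpow (psi x) k.
  by elim: k => [|k IH]; [exact: hom_one|rewrite /lpow /= hp -/(lpow mul one x k) IH].
have [|||x k k0|U nU h] := @power_growth_locally_zero L mul one inv lcg (fun x : L => len (psi x)).
- by move=> x y; rewrite hp len_mul.
- by move=> x; rewrite hom_inv // len_inv.
- by rewrite hom_one // len_one.
- by rewrite hpow; apply: len_gpow.
- by exists U => // x /h/len_eq0.
Qed.

Definition local_in (psi : L -> gpG) (S : set V) a : Prop :=
  exists2 U, nbhs one U & forall x : L, U x -> GS S (gmul (ginv a) (gmul (psi x) a)).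

Notation lk_list S := (link E (mem_list S)).

Lemma enlarge_clique phi S s a (x0 : L) : hom phi ->
  local_in phi (mem_list S `|` lk_list S) a ->
  rotation s (rho (lk_list S) (gmul (ginv a) (gmul (phi x0) a))) ->
  lk_list S s /\ exists b, local_in phi (mem_list (s :: S) `|` lk_list (s :: S)) b.
Proof.
move=> hp [U nU hU] [b [y [l [ys ty lk e]]]].
set T := lk_list S in e *.
pose psi (x : L) := rho T (gmul (ginv a) (gmul (phi x) a)).
have hpsi : hom psi by move=> x z; rewrite /psi hom_conj // rho_mul.
have ST t v : mem_list S t -> T v -> E t v by move=> St; apply.
(* Otherwise [r_s] would kill the image of [rho T], but it does not kill a rotation of type [s]. *)
have Ts : T s.
  apply: contrapT => nTs; apply: ty; apply: (rr_rot ys lk); apply: (@rr_conj _ b).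
  rewrite -e; have [w Tw ->] := GS_rhoT T (gmul (ginv a) (gmul (phi x0) a)).
  by apply: rr_nin; apply: inS_sub Tw => v Tv vs; apply: nTs; rewrite -vs.
(* [b] may lie outside [G_T]; applying [rho T] to the conjugation lets [rho T b] replace it, and
   this element commutes with [G_S]. *)
split=> //; exists (gmul a (rho T b)).
have [U1 nU1 h1] := rotation_star hpsi ys ty lk e.
exists (U `&` U1); first exact: filterI.
move=> x [/hU Ug /h1 U1g].
set g := gmul (ginv a) (gmul (phi x) a) in Ug.
set t := gmul (ginv b) (gmul (psi x) b) in U1g.
have [sg Ssg eg] := GS_prod ST Ug.
have ep : rho T g = gmul (rho T b) (gmul (rho T t) (ginv (rho T b))).
  have -> : rho T g = rho T (psi x) by rewrite (rho_id (GS_rhoT _ _)).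
  rewrite -rho_inv -!rho_mul; congr rho; rewrite /t; by gsimp.
have cm : gmul sg (rho T b) = gmul (rho T b) sg by apply: GS_comm ST Ssg (GS_rhoT _ _).
have -> : gmul (ginv (gmul a (rho T b))) (gmul (phi x) (gmul a (rho T b))) = gmul sg (rho T t).
  have -> : gmul (ginv (gmul a (rho T b))) (gmul (phi x) (gmul a (rho T b))) =
            gmul (ginv (rho T b)) (gmul g (rho T b)) by rewrite /g; gsimp.
  rewrite eg ep -!gmulA gmulVg gmulg1 (gmulA sg) cm; by gsimp.
apply: GS_mul.
  by apply: GS_sub Ssg => v Sv; left; right.
apply: GS_sub (GS_rho T U1g) => v [[->|sv] Tv]; first by left; left.
by right=> u [<-//|]; apply: Tv.
Qed.

Lemma locally_in_clique phi : finite_dimension E -> hom phi ->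
  exists S a, clq S /\ local_in phi (mem_list S) a.
Proof.
move=> [N fd] hp.
pose P n := exists S, [/\ clq S, N - size S = n &
  exists a, local_in phi (mem_list S `|` lk_list S) a].
have [|n [S [cS sz [a la]]] nmin] := @nat_min P.
  (* The empty clique qualifies because its link is [V]. Minimising [N - size S] maximises the size
     of the clique. *)
  exists N, [::]; split=> //; first by rewrite subn0.
  exists (gone gpG), setT; first exact: filterT.
  move=> x _; exists (repr (gmul (ginv (gone gpG)) (gmul (phi x) (gone gpG)))); last by rewrite reprK.
  by apply/allT => z; apply/asboolP; right=> v [].
pose T := lk_list S.
pose psi (x : L) := rho T (gmul (ginv a) (gmul (phi x) a)).
have hpsi : hom psi by move=> x z; rewrite /psi hom_conj // rho_mul.
case: (pselect (exists s (x : L), rotation s (psi x))) => [[s [x rx]]|nrot].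
  have [Ts [b lb]] := enlarge_clique hp la rx.
  have cS' : clq (s :: S) by split=> // v /Ts/Esym.
  have := clq_size fd cS'; rewrite /= => szN.
  have : n <= N - size (s :: S) by apply: nmin; exists (s :: S); split=> //; exists b.
  by rewrite -sz /=; move: szN; clear; lia.
have [|U1 nU1 h1] := no_rotation_trivial hpsi.
  by move=> s x rx; apply: nrot; exists s, x.
exists S, a; split=> //; have [U nU h] := la.
exists (U `&` U1); first exact: filterI.
move=> x [/h Ug /h1 U1g]; have [|sg Ssg ->] := GS_prod _ Ug.
  by move=> t v St; apply.
by rewrite -/T -/(psi x) U1g gmulg1.
Qed.

Lemma minimal_clique phi : finite_dimension E -> hom phi ->
  exists S a, [/\ clq S, local_in phi (mem_list S) a &
    forall s U, mem_list S s -> nbhs one U -> exists (x : L) y l,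
      [/\ U x, [/\ vt y = s, ~ triv y & inlk s l] &
          gmul (ginv a) (gmul (phi x) a) = cls (y :: l)]].
Proof.
move=> fd hp; have [S0 [a0 [cS0 l0]]] := locally_in_clique fd hp.
pose P n := exists S a, [/\ clq S, size S = n & local_in phi (mem_list S) a].
have [|n [S [a [cS sz la]]] nmin] := @nat_min P.
  by exists (size S0), S0, a0.
exists S, a; split=> // s U Ss nU; apply: contrapT => nex.
have [S' [cS' sz' lkS' _ SS']] := clq_rem cS Ss.
suff : n <= size S' by rewrite -sz leqNgt sz'.
apply: nmin; exists S', a; split=> //; have [U1 nU1 h1] := la.
exists (U `&` U1); first exact: filterI.
move=> x [Ux /h1[w Sw e]].
have [|y [l [ys Sl e']]] := @split_star s _ w lkS'; first exact: inS_sub Sw.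
case: (pselect (triv y)) => [ty|nty].
  by rewrite e e' cls_cons cls_triv // gmul1g; apply: GS_cls.
case: nex; exists x, y, l; split=> //; last by rewrite e.
by split=> //; apply: inS_sub Sl.
Qed.

(** For [z] near the identity, [psi (x z x^-1)] still lies in [G_st(s)]. If [psi z] is a rotation
    about [q], [nu_conj] forces [psi x] to fix [q]. Intersecting the groups [G_st(s)] over [s] in
    [S] leaves [S] and its link. *)
Lemma normalizes_clique phi S a : hom phi -> clq S -> local_in phi (mem_list S) a ->
  (forall s U, mem_list S s -> nbhs one U -> exists (x : L) y l,
      [/\ U x, [/\ vt y = s, ~ triv y & inlk s l] &
          gmul (ginv a) (gmul (phi x) a) = cls (y :: l)]) ->
  forall x : L, GS (mem_list S `|` lk_list S) (gmul (ginv a) (gmul (phi x) a)).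
Proof.
move=> hp cS [U nU hU] rot x.
pose psi (x : L) := gmul (ginv a) (gmul (phi x) a).
have hpsi : hom psi by apply: hom_conj.
rewrite -/(psi x).
suff st_all s : mem_list S s -> star s (psi x).
  apply: GS_sub (GS_inter st_all) => v stv.
  case: (pselect (mem_list S v)) => Sv; [by left|right=> s Ss].
  by case: (stv s Ss) => // vs; case: Sv; rewrite vs.
move=> Ss.
have nU' : nbhs one [set z | U (mul x (mul z (inv x)))].
  have c : continuous (fun z : L => mul x (mul z (inv x))).
    apply: (mul_continuous lcg); first exact: cst_cont.
    by apply: (mul_continuous lcg); [exact: id_cont|exact: cst_cont].
  have := c one; apply; case: lcg => -[_ m1 _ _ mV] _ _ _ _.
  by rewrite m1 mV.
have [z [y [l [/hU Uz [ys ty lk] e]]]] := rot s _ Ss nU'.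
have stz : star s (psi (mul x (mul z (inv x)))).
  apply: GS_sub Uz => v Sv; case: (pselect (v = s)) => [|vs]; [by left|right].
  by apply: (clq_clique cS) => // sv; apply: vs.
apply: nu0; have := nu_conj (psi x) ys ty lk.
rewrite -e -/(psi z) -(hom_inv _ hpsi) -!hpsi (nu_star stz).
by rewrite leqn0 double_eq0 => /eqP.
Qed.

Lemma locally_trivial_continuous phi : hom phi -> local_in phi set0 (gone gpG) ->
  forall g, open [set x : L | phi x = g].
Proof.
move=> hp [U nU hU] g; rewrite openE => x /= xg; rewrite /interior.
have [[mA m1 mx mV mV'] _ _ _ _] := lcg.
have c : continuous (fun z : L => mul (inv x) z).
  by apply: (mul_continuous lcg); [exact: cst_cont|exact: id_cont].
have : nbhs x [set z | U (mul (inv x) z)] by have := c x; apply; rewrite mV.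
apply: filterS => z /= /hU/GS_set0; rewrite ginv1 gmul1g gmulg1 hp (hom_inv _ hp) => e.
by rewrite -xg -(gmulKVg (phi x) (phi z)) e gmulg1.
Qed.

End Homomorphism.

End GraphProductWords.

Theorem theoremB
  (V : Type) (E : V -> V -> Prop) (G : V -> grp)
  (L : topologicalType) (mul : L -> L -> L) (one : L) (inv : L -> L)
  (phi : L -> word G) :
  simplicial_graph E ->
  finite_dimension E ->
  (forall v, nontrivial_grp (G v)) ->
  locally_compact_group mul one inv ->
  gp_hom mul E phi ->
  (gp_continuous E phi \/
   exists (S : set V) (g : word G),
     [/\ S !=set0, clique E S &
         forall x : L, exists h : word G,
           in_GS E (S `|` link E S) h /\
           gp_eq E (phi x) (wmul g (wmul h (winv g)))])
  /\
  ((forall v : V, discrete_continuous (fun x => retraction v (phi x))) ->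
   gp_continuous E phi).
Proof.
move=> [Esym Eirr] fd _ lcg hphi.
pose psi x : gpG E G := cls E (phi x).
have hp : hom mul psi by move=> x y; rewrite /psi -cls_cat; apply: cls_gp; apply: hphi.
have [S [a [cS la rot]]] := minimal_clique Esym Eirr lcg fd hp.
(* For empty [S] the map is trivial near the identity, hence locally constant. *)
have cont : S = [::] -> gp_continuous E phi.
  move=> S0 w; have h : local_in one psi set0 (gone (gpG E G)).
    have [U nU hU] := la; exists U => // x /hU; rewrite S0 => h.
    have {h} /GS_set0 e : GS set0 (gmul (ginv a) (gmul (psi x) a)) by apply: GS_sub h.
    have -> : psi x = gone _; last by rewrite gmul1g gmulVg; apply: GS_one.
    rewrite -(gmulKVg a (psi x)) -[gmul (ginv a) (psi x)]gmulg1 -(gmulgV a) -!gmulA.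
    by rewrite (gmulA (psi x)) (gmulA (ginv a)) e gmul1g gmulgV.
  have := locally_trivial_continuous lcg hp h (cls E w).
  by congr open; apply/seteqP; split=> x /= /clsP.
split.
  case: (pselect (S = [::])) => [/cont|S0]; [by left|right].
  exists (mem_list S), (repr a); split.
  - by case: (S) S0 => // s S' _; exists s; left.
  - exact: clq_clique.
  move=> x; have [w Sw e] := normalizes_clique Esym Eirr lcg hp cS la rot x.
  exists w; split; first by exists w; split=> //; apply: gp_refl.
  apply/clsP; rewrite /wmul !cls_cat cls_winv -e reprK -/(psi x).
  by rewrite -!gmulA gmulKVg gmulgV gmulg1.
(* If [s] were in [S], the open kernel of [r_s o phi] would contain some [x] for which [phi x] is a
   conjugate of [y l] with [y] nontrivial at [s]. *)
move=> rc; apply: cont; case: S cS la rot => // s S cS la rot.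
have [||x [y [l [/= rx [ys ty lk] e]]]] := rot s [set x | retraction s (phi x) = gone (G s)].
- by left.
- apply: open_nbhs_nbhs; split; first exact: rc.
  by rewrite /= -(rr_cls Eirr) -/(psi one) (hom_one lcg hp) rr_one.
case: ty; apply: (rr_rot Eirr ys lk); rewrite -e.
apply: (rr_conj Eirr (g := a)); rewrite -!gmulA gmulKVg gmulgV gmulg1.
by rewrite (rr_cls Eirr).
Qed.
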